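(* Let $F_{\Psi}:\mathcal{R}\to\mathcal{R}$ be the $\Psi$-lift of an expanding interval map $F$ and let $\alpha\in\mathbb{R}$. Then $\delta_\alpha=\delta$ if and only if $\mu_{\delta\varphi}(\psi)=\alpha$. In particular, a dimension gap occurs for $F_\Psi$ if and only if $\mu_{\delta\varphi}(\psi)\ne0$.
   Context: Setting. Let $I=\{1,\dots,m\}$, $m\ge 2$, and let $I_i\subset[0,1]$, $i\in I$, be pairwise disjoint intervals with non-empty interior. $F$ is an expanding interval map with $C^{1+\epsilon}$ full branches $F|_{I_i}:I_i\to[0,1]$: the continuous continuation $H_i$ of $F|_{I_i}$ to $\overline{I_i}$ is a $C^{1+\epsilon}$ diffeomorphism of $\overline{I_i}$ onto $[0,1]$ with $|H_i'|>1$. Put $h_i=H_i^{-1}:[0,1]\to\overline{I_i}$. Let $\Sigma=I^{\mathbb{N}}$ with left shift $\sigma$ and metric $d(\omega,\tau)=\exp(-\max\{k\ge0:\omega_1=\tau_1,\dots,\omega_k=\tau_k\})$, and let $\pi:\Sigma\to[0,1]$ be the coding map, $\{\pi(\omega)\}=\bigcap_{n}h_{\omega_1}\circ\cdots\circ h_{\omega_n}([0,1])$. Let $I^\star$ be the set of all finite words over $I$ (including the empty word), $|\omega|$ the length of $\omega\in I^\star$, and $[\omega]=\{x\in\Sigma: x|_{|\omega|}=\omega\}$ the cylinder of $\omega$. Let $\mathcal{D}=\bigcup_{(\omega_1,\dots,\omega_n)\in I^\star}h_{\omega_1}\circ\cdots\circ h_{\omega_n}(\{0,1\})$ (the empty word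 contributing $\{0,1\}$) and $\mathcal{R}=(\pi(\Sigma)\setminus\mathcal{D})+\mathbb{Z}\subset\mathbb{R}$. Let $\Psi:[0,1]\to\mathbb{Z}$ be constant on each $I_i$. The $\Psi$-lift of $F$ is $F_\Psi:\mathcal{R}\to\mathcal{R}$, $F_\Psi(x)=\sum_{k\in\mathbb{Z}}\big(k+F(x-k)+\Psi(x-k)\big)\mathbf{1}_{[0,1]}(x-k)$. For $f:\Sigma\to\mathbb{R}$ put $S_nf=\sum_{k=0}^{n-1}f\circ\sigma^k$ and, for $\omega\in I^\star$, $S_\omega f=\sup_{x\in[\omega]}S_{|\omega|}f(x)$. The geometric potential $\varphi:\Sigma\to(-\infty,0)$ is the Hölder continuous function with $\varphi(\omega)=-\log|F'(\pi(\omega))|$ except possibly on a finite set (i.e. $\varphi(\omega)=-\log|H_{\omega_1}'(\pi(\omega))|$). The symbolic step length function $\psi:\Sigma\to\mathbb{Z}$ is constant on one-cylinder sets and equals $\Psi\circ\pi$ except possibly on a finite set (i.e. $\psi(\omega)$ is the value of $\Psi$ on $I_{\omega_1}$). The classical topological pressure of a continuous $f:\Sigma\to\mathbb{R}$ is $\mathfrak{P}(f)=\lim_{n\to\infty}\frac1n\log\sum_{\omega\in I^n}\exp(S_\omega f)$. The number $\delta>0$ is the unique $s$ with $\mathfrak{P}(s\varphi)=0$; by Bowen's formula it is the Hausdorff dimension of $\pi(\Sigma)$ and of $\mathcal{R}$. For Hölder continuous $f$, $\mu_f$ is the Gibbs measure of $f$: the unique $\sigma$-invariant Borel probability measure on $\Sigma$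 for which there is $c\ge1$ with $c^{-1}\le\mu_f([\omega])/\exp(S_nf(x)-n\mathfrak{P}(f))\le c$ for all $n\in\mathbb{N}$, $\omega\in I^n$, $x\in[\omega]$. Write $\mu(\psi)=\int\psi\,d\mu$. For $\alpha\in\mathbb{R}$ the $\alpha$-Poincaré exponent is $\delta_\alpha=\inf\{s\ge0:\sum_{\omega\in I^\star,\,|S_\omega(\psi-\alpha)|\le K}e^{s\,S_\omega\varphi}<\infty\}$, where $K>0$ is sufficiently large. Recurrent set: $\mathbf{R}=\{x\in\mathcal{R}:\exists K\in\mathbb{R}\text{ such that }|F_\Psi^n(x)|\le K\text{ for infinitely many }n\in\mathbb{N}\}$. Uniformly recurrent set: $\mathbf{R}_u=\{x\in\mathcal{R}:\exists K\in\mathbb{R}\ \forall n\in\mathbb{N}\ |F_\Psi^n(x)|\le K\}$. Both have Hausdorff dimension $\delta_0$. The system $F_\Psi$ has a dimension gap if the Hausdorff dimension $\delta_0$ of the (uniformly) recurrent set is strictly less than the Hausdorff dimension $\delta$ of $\mathcal{R}$. *)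

(* Defs.v *)
From HB Require Import structures.
From mathcomp Require Import all_boot all_order all_algebra.
From mathcomp Require Import all_classical all_reals all_analysis.
Import Order.TTheory GRing.Theory Num.Theory.
Import numFieldNormedType.Exports.

Set Implicit Arguments.
Unset Strict Implicit.
Unset Printing Implicit Defensive.

Local Open Scope classical_set_scope.
Local Open Scope ring_scope.

(** * Hausdorff dimension of subsets of the real line *)

Section hausdorff.
Context {R : realType}.
Implicit Types (U E : set R) (s r : R).

(* [diam set0 = -oo], which satisfies every bound on diameters. *)
Definition diam U : \bar R :=
  ereal_sup [set `|z.1 - z.2|%:E | z in U `*` U].

(* The case distinction only matters for [s = 0]. *)
Definition diam_pow s U : \bar R :=
  if U == set0 then 0%E else (diam U `^ s)%E.

Definition hausdorff_premeasure s r E : \bar R :=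
  ereal_inf [set (\sum_(0 <= i <oo) diam_pow s (U i))%E
            | U in [set U : (set R)^nat |
                     (forall i, (diam (U i) <= r%:E)%E) /\
                     E `<=` \bigcup_i U i]].

Definition hausdorff_measure s E : \bar R :=
  ereal_sup [set hausdorff_premeasure s r E | r in [set r | 0 < r]].

Definition hausdorff_dim E : \bar R :=
  ereal_inf [set s%:E | s in [set s | 0 <= s /\ hausdorff_measure s E = 0%E]].

End hausdorff.

(** * Expanding interval maps with C^{1+eps} full branches *)

Section smooth.
Context {R : realType}.
Implicit Types (J : set R) (f g : R -> R) (x : R).

(* Derivatives relative to [J], hence one-sided at the end points of [J];
   the values of [f] outside [J] are irrelevant. *)
Definition diff_quot f x : R -> R := fun y => (f y - f x) / (y - x).

Definition derivable_within J f x : Prop :=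
  cvg (diff_quot f x @ within J x^').

Definition derive_within J f x : R := lim (diff_quot f x @ within J x^').

Definition C1_holder (eps : R) J f : Prop :=
  (forall x, J x -> derivable_within J f x) /\
  exists C : R, forall x y, J x -> J y ->
    `|derive_within J f x - derive_within J f y| <= C * `|x - y| `^ eps.

(* [f] is a diffeomorphism of [J] onto [J'] of class C^{1+eps}, with
   inverse [g]. *)
Definition C1_holder_diffeo (eps : R) J J' f g : Prop :=
  [/\ forall x, J x -> J' (f x) /\ g (f x) = x,
      forall y, J' y -> J (g y) /\ f (g y) = y,
      C1_holder eps J f & C1_holder eps J' g].

End smooth.

(* [emap F] only matters on the union of the [edom F i], [branch F i] (the
   H_i) only on [closure (edom F i)] and [ibranch F i] (the h_i) only on the
   unit interval. *)
Record expanding_map (R : realType) (I : Type) := ExpandingMap {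
  edom : I -> set R;
  emap : R -> R;
  branch : I -> R -> R;
  ibranch : I -> R -> R;
  edom_sub : forall i, edom i `<=` `[0, 1];
  edom_interval : forall i, is_interval (edom i);
  edom_interior : forall i, interior (edom i) !=set0;
  edom_disjoint : trivIset setT edom;
  branchE : forall i x, edom i x -> branch i x = emap x;
  branch_diffeo : exists2 eps : R, 0 < eps &
    forall i, C1_holder_diffeo eps (closure (edom i)) `[0, 1]
                (branch i) (ibranch i);
  branch_expanding : forall i x, closure (edom i) x ->
    1 < `|derive_within (closure (edom i)) (branch i) x|
}.

(** * Symbolic dynamics over the alphabet ['I_p.+2], i.e. m = p + 2 >= 2 *)

Section symbolic.
Context {R : realType} {p : nat}.

Definition word := seq 'I_p.+2.
Definition sigma := nat -> 'I_p.+2.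

Implicit Types (x y : sigma) (w : word) (f : sigma -> R).

Definition left_shift x : sigma := fun n => x n.+1.

(* x|_n *)
Definition prefix_of x n : word := mkseq x n.

Definition cylinder w : set sigma := [set x | prefix_of x (size w) = w].

(* exp (- max {k | x, y agree up to k}), with value 0 if x = y. *)
Definition sigma_dist x y : R :=
  inf [set expR (- k%:R) | k in [set k | prefix_of x k = prefix_of y k]].

Definition sigma_open (U : set sigma) : Prop :=
  forall x, U x -> exists2 e : R, 0 < e & forall y, sigma_dist x y < e -> U y.

(* S_n f *)
Definition birkhoff n f x : R := \sum_(0 <= k < n) f (iter k left_shift x).

(* S_w f *)
Definition birkhoff_sup w f : R := sup [set birkhoff (size w) f x | x in cylinder w].

Definition pressure f : R :=
  limn (fun n => n%:R^-1 *
    ln (\sum_(w : n.-tuple 'I_p.+2) expR (birkhoff_sup w f))).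

End symbolic.
Arguments word : clear implicits.
Arguments sigma : clear implicits.

HB.instance Definition _ (p : nat) :=
  Choice.copy (sigma p) (nat -> 'I_p.+2).
HB.instance Definition _ (p : nat) :=
  isPointed.Build (sigma p) (fun=> ord0).

(* The sequence space with the Borel sigma-algebra of [sigma_dist]. *)
Definition borel_sigma (R : realType) (p : nat) :=
  g_sigma_algebraType (@sigma_open R p).

Definition gibbs_measure (R : realType) (p : nat) (f : sigma p -> R)
    (mu : probability (borel_sigma R p) R) : Prop :=
  (forall A : set (borel_sigma R p), measurable A ->
     mu (left_shift @^-1` A) = mu A) /\
  exists2 c : R, 1 <= c &
    forall (n : nat) (w : n.-tuple 'I_p.+2) (x : sigma p), cylinder w x ->
      c^-1 <= fine (mu (cylinder w)) / expR (birkhoff n f x - n%:R * pressure f)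
           <= c.

(** * Coding, potentials, and the lift *)

Section lift.
Context {R : realType} {p : nat}.
Variables (F : expanding_map R 'I_p.+2) (Psi : R -> int).

(* h_{w_1} \o ... \o h_{w_n} *)
Definition ibranch_word (w : word p) : R -> R :=
  foldr (fun i g => ibranch F i \o g) id w.

Definition coding (x : sigma p) : R :=
  xget 0 (\bigcap_n (ibranch_word (prefix_of x n) @` `[0, 1])).

Definition endpoints : set R :=
  \bigcup_(w : word p) (ibranch_word w @` [set 0; 1]).

(* The domain of the lift: (coding(sigma) \ endpoints) + Z *)
Definition lift_dom : set R :=
  [set z.1 + z.2%:~R | z in (range coding `\` endpoints) `*` [set: int]].

(* At most two summands are nonzero. *)
Definition psi_lift (x : R) : R :=
  \sum_(k \in [set: int])
    (k%:~R + emap F (x - k%:~R) + (Psi (x - k%:~R))%:~R)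
      * \1_(`[0, 1] : set R) (x - k%:~R).

(* The geometric potential and the symbolic step length function. *)
Definition geom_potential (x : sigma p) : R :=
  - ln `|derive_within (closure (edom F (x 0%N))) (branch F (x 0%N)) (coding x)|.

Definition step_length (x : sigma p) : int := Psi (xget 0 (edom F (x 0%N))).

(* The words w with |S_w (psi - alpha)| <= K. *)
Definition words_near (alpha K : R) : set (word p) :=
  [set w | `|birkhoff_sup w (fun x => (step_length x)%:~R - alpha)| <= K].

Definition poincare_exponent (alpha K : R) : R :=
  inf [set s | 0 <= s /\
    ((\esum_(w in words_near alpha K)
        (expR (s * birkhoff_sup w geom_potential))%:E)%R < +oo)%E].

Definition recurrent_set : set R :=
  [set x | lift_dom x /\ exists K : R,
     forall N, exists2 n, (N <= n)%N & `|iter n psi_lift x| <= K].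

Definition uniformly_recurrent_set : set R :=
  [set x | lift_dom x /\ exists K : R, forall n, `|iter n psi_lift x| <= K].

(* The dimension gap, relative to a set [E] of recurrent points. *)
Definition dimension_gap (E : set R) : Prop :=
  (hausdorff_dim E < hausdorff_dim lift_dom)%E.

End lift.

(* Main.v *)
(* Write [l w] for the length of the interval coded by the word [w].  By bounded
   distortion [exp (s S_w phi)] is comparable to [l w ^ s], [l] is
   multiplicative up to constants, and [mu [w]] is comparable to
   [l w ^ delta]; so [mu] is multiplicative on cylinders up to constants.

   Let X be a function of one letter with mean 0.  Since
   [mu [uv] >= kap mu [u] mu [v]], the variance of [S_n X] grows by a factor
   less than 4 when n doubles, and the weak law of large numbers holds along
   powers of 2.
   - If [psi - alpha] has mean 0, most words of length n have sum at most
     [eps n] in absolute value; appending about [eps n] letters brings the sum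
     back to a bounded range, at a cost beaten by the factor [exp (c n)] gained
     by taking s < delta.  Hence the sum of [l w ^ s] over the words of a fixed
     length with bounded [S_w (psi - alpha)] can be made arbitrarily large, and
     the Poincare series diverges at s.  For alpha = 0, concatenating such words
     produces a tree of uniformly recurrent codes in which the children of a
     node have [sum l ^ s] at least twice that of the node; its limit set has
     dimension at least s.
   - If the mean is not 0, an exponential moment of [S_n (psi - alpha)] decays,
     so the words of length n with bounded sum have [sum l w ^ s <= C q ^ n] for
     some s < delta and q < 1; this bounds the Poincare exponent and, by
     covering, the dimension of the recurrent set.
   With X = 0 the same tree argument shows that the domain of the lift has
   dimension delta. *)

Require Import Defs.
From mathcomp Require Import all_boot all_order all_algebra.
From mathcomp Require Import all_classical all_reals all_analysis.
From mathcomp Require Import ring lra zify.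
Import Order.TTheory GRing.Theory Num.Theory.
Import numFieldNormedType.Exports.

Set Implicit Arguments.
Unset Strict Implicit.
Unset Printing Implicit Defensive.

Local Open Scope classical_set_scope.
Local Open Scope ring_scope.

(** * Sums over words *)

Lemma geometric_small {R : realType} (x c b : R) : 0 <= x < 1 -> 0 <= c -> 0 < b ->
  exists n0, forall n, (n0 <= n)%N -> c * x ^+ n <= b.
Proof.
move=> /andP[x0 x1] c0 b0.
have b1 : 0 < b / (1 + c) by rewrite divr_gt0// ltr_wpDr.
have /cvgrPdist_lt/(_ _ b1)[n0 _ Hn0] : (fun n => x ^+ n) @ \oo --> (0 : R).
  by apply: cvg_expr; rewrite ger0_norm.
exists n0 => n /Hn0 /=; rewrite sub0r normrN ger0_norm ?exprn_ge0//.
rewrite ltr_pdivlMr ?ltr_wpDr// mulrDr mulr1 mulrC => /ltW; apply: le_trans.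
by rewrite lerDr exprn_ge0.
Qed.

Section words.
Variable A : finType.

(** Lists rather than tuples: sums over words of length n + k then split along concatenation without
    casts. *)
Fixpoint words (n : nat) : seq (seq A) :=
  if n is n'.+1 then [seq i :: w | i <- index_enum A, w <- words n'] else [:: [::]].

Lemma mem_words n w : (w \in words n) = (size w == n).
Proof.
elim: n w => [|n IH] w; first by rewrite inE; case: w.
apply/allpairsP/eqP => [[[i v] [_ + ->]]|]; first by rewrite IH => /eqP <-.
by case: w => // i v [sv]; exists (i, v); rewrite mem_index_enum IH sv eqxx.
Qed.

Lemma words_uniq n : uniq (words n).
Proof.
elim: n => // n IH; apply: allpairs_uniq => //; first exact: index_enum_uniq.
by move=> [i u] [j v] _ _ [-> ->].
Qed.

Context {R : realType}.
Implicit Types (f : seq A -> R).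

Lemma big_words0 (P : pred (seq A)) f : \sum_(w <- words 0 | P w) f w = if P [::] then f [::] else 0.
Proof. by rewrite /= big_cons big_nil addr0. Qed.

Lemma big_wordsS n f :
  \sum_(w <- words n.+1) f w = \sum_i \sum_(w <- words n) f (i :: w).
Proof. by rewrite /= big_allpairs_dep. Qed.

Lemma big_wordsD n k f :
  \sum_(w <- words (n + k)) f w =
  \sum_(u <- words n) \sum_(v <- words k) f (u ++ v).
Proof.
elim: n f => [|n IH] f; first by rewrite big_words0.
rewrite addSn !big_wordsS; apply: eq_bigr => i _.
exact: (IH (fun w => f (i :: w))).
Qed.

Lemma ler_words_size n f g : (forall w, size w = n -> f w <= g w) ->
  \sum_(w <- words n) f w <= \sum_(w <- words n) g w.
Proof.
move=> fg; rewrite big_seq [leRHS]big_seq; apply: ler_sum => w.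
by rewrite mem_words => /eqP /fg.
Qed.

End words.

(** The Birkhoff sum, along a word, of a function that depends on one letter only. *)
Definition wsum {R : realType} {A : finType} (X : A -> R) (w : seq A) : R := \sum_(i <- w) X i.

Section wsum.
Context {R : realType} {A : finType}.
Implicit Types (X : A -> R) (w : seq A).

Lemma wsum_cat X u v : wsum X (u ++ v) = wsum X u + wsum X v.
Proof. exact: big_cat. Qed.

Lemma wsum_cons X i w : wsum X (i :: w) = X i + wsum X w.
Proof. exact: big_cons. Qed.

Lemma wsum_nil X : wsum X [::] = 0.
Proof. exact: big_nil. Qed.

Lemma wsumB X (a : R) w : wsum (fun i => X i - a) w = wsum X w - (size w)%:R * a.
Proof.
elim: w => [|i w IH]; first by rewrite !wsum_nil /= mul0r subr0.
by rewrite !wsum_cons IH /= -[(size w).+1]addn1 natrD; ring.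
Qed.

Lemma wsumN X w : wsum (fun i => - X i) w = - wsum X w.
Proof. exact: sumrN. Qed.

Lemma wsum_norm_le X M w : (forall i, `|X i| <= M) -> `|wsum X w| <= M *+ size w.
Proof.
move=> XM; elim: w => [|i w IH]; first by rewrite wsum_nil normr0.
by rewrite wsum_cons mulrS (le_trans (ler_normD _ _))// lerD.
Qed.

Lemma finite_bound X : exists2 M, 0 < M & forall i, `|X i| <= M.
Proof.
exists (1 + \sum_i `|X i|); first by rewrite ltr_pwDl// sumr_ge0.
move=> i; rewrite (bigD1 i)//= addrCA lerDl addr_ge0// sumr_ge0//.
Qed.

End wsum.

(** * Weak law of large numbers for quasi-Bernoulli masses *)

Section lln.
Variables (R : realType) (A : finType) (m : seq A -> R) (kap : R) (X : A -> R).
Hypotheses (m_ge0 : forall w, 0 <= m w) (m_nil : m [::] = 1)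
  (m_rcons : forall w, \sum_i m (w ++ [:: i]) = m w)
  (m_cons : forall w, \sum_i m (i :: w) = m w)
  (kap_gt0 : 0 < kap) (m_cat : forall u v, kap * (m u * m v) <= m (u ++ v)).

(** Iterates [m_rcons], the additivity of the mass on cylinders; the counterpart [sum_catl] iterates
    [m_cons], which expresses shift invariance. *)
Lemma sum_catr n u : \sum_(v <- words A n) m (u ++ v) = m u.
Proof.
elim: n u => [|n IH] u; first by rewrite big_words0 cats0.
rewrite big_wordsS -[RHS]m_rcons; apply: eq_bigr => i _.
by rewrite -(IH (u ++ [:: i])); apply: eq_bigr => v _; rewrite -catA.
Qed.

Lemma sum_catl n v : \sum_(u <- words A n) m (u ++ v) = m v.
Proof.
elim: n v => [|n IH] v; first by rewrite big_words0.
by rewrite big_wordsS exchange_big /= -[RHS]IH; apply: eq_bigr => u _; rewrite m_cons.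
Qed.

Lemma sum_words n : \sum_(u <- words A n) m u = 1.
Proof. by rewrite -m_nil -(sum_catr n). Qed.

Let V n := \sum_(w <- words A n) m w * wsum X w ^+ 2.

Hypothesis meanX : \sum_i m [:: i] * X i = 0.

Lemma mean_wsum n : \sum_(w <- words A n) m w * wsum X w = 0.
Proof.
elim: n => [|n IH]; first by rewrite big_words0 wsum_nil mulr0.
rewrite big_wordsS.
under eq_bigr do under eq_bigr do rewrite wsum_cons mulrDr.
under eq_bigr do rewrite big_split.
rewrite /= big_split /=.
under eq_bigr => i _ do rewrite -mulr_suml (sum_catr n [:: i]).
rewrite meanX add0r exchange_big /=.
by under eq_bigr do rewrite -mulr_suml m_cons.
Qed.

(** A factor 4 would only match the growth of n ^ 2 under doubling; the gain [2 * kap] is what makes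
    [V n / n ^ 2] tend to 0 along powers of 2. *)
Lemma variance_double n : V (n + n) <= (4 - 2 * kap) * V n.
Proof.
have V1 : \sum_(u <- words A n) \sum_(v <- words A n) m (u ++ v) * wsum X u ^+ 2 = V n.
  by apply: eq_bigr => u _; rewrite -mulr_suml sum_catr.
have V2 : \sum_(u <- words A n) \sum_(v <- words A n) m (u ++ v) * wsum X v ^+ 2 = V n.
  by rewrite exchange_big; apply: eq_bigr => v _; rewrite -mulr_suml sum_catl.
have V3 : \sum_(u <- words A n) \sum_(v <- words A n) (m u * m v) * wsum X u ^+ 2 = V n.
  apply: eq_bigr => u _; rewrite -[RHS]mulr1 -(sum_words n) mulr_sumr.
  by apply: eq_bigr => v _; ring.
have V4 : \sum_(u <- words A n) \sum_(v <- words A n) (m u * m v) * wsum X v ^+ 2 = V n.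
  by rewrite exchange_big -V3; do 2!apply: eq_bigr => ? _; congr (_ * _); rewrite mulrC.
have V5 : \sum_(u <- words A n) \sum_(v <- words A n)
    (m u * m v) * (wsum X u * wsum X v) = 0.
  rewrite big1// => u _.
  under eq_bigr do rewrite mulrACA.
  by rewrite -mulr_sumr mean_wsum mulr0.
(* Summing [(m (u ++ v) - kap * m u * m v) * (wsum X u - wsum X v) ^+ 2 >= 0]
   bounds the covariance of the two halves. *)
have : V (n + n) <= \sum_(u <- words A n) \sum_(v <- words A n)
    (2 * (m (u ++ v) * wsum X u ^+ 2) + 2 * (m (u ++ v) * wsum X v ^+ 2)
     - kap * ((m u * m v) * wsum X u ^+ 2) - kap * ((m u * m v) * wsum X v ^+ 2)
     + 2 * kap * ((m u * m v) * (wsum X u * wsum X v))).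
  rewrite /V big_wordsD; apply: ler_sum => u _; apply: ler_sum => v _.
  rewrite wsum_cat -subr_ge0.
  have k0 : 0 <= m (u ++ v) - kap * (m u * m v) by rewrite subr_ge0.
  by have := mulr_ge0 k0 (sqr_ge0 (wsum X u - wsum X v)); lra.
under eq_bigr do rewrite !(big_split, sumrN) /= -!mulr_sumr.
rewrite !(big_split, sumrN) /= -!mulr_sumr V1 V2 V3 V4 V5; lra.
Qed.

Lemma weak_law eta : 0 < eta ->
  exists k0, forall k, (k0 <= k)%N -> V (2 ^ k) <= eta * (2 ^ k)%:R ^+ 2.
Proof.
move=> eta0.
(* Ensures that q, the factor 4 - 2 kap of the variance divided by the factor 4 of n ^ 2, is
   nonnegative. *)
have kap1 : kap <= 1.
  by have := m_cat [::] [::]; rewrite m_nil !mulr1.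
set q := 1 - kap / 2.
have q01 : 0 <= q < 1 by move: kap_gt0; rewrite /q => ?; apply/andP; split; lra.
have /andP[q0 _] := q01.
have V0 n : 0 <= V n by apply: sumr_ge0 => w _; rewrite mulr_ge0 ?sqr_ge0.
have Vk k : V (2 ^ k) <= q ^+ k * V 1 * (2 ^ k)%:R ^+ 2.
  elim: k => [|k IH]; first by rewrite expn0 expr0 mul1r expr1n mulr1.
  rewrite expnS mul2n -addnn (le_trans (variance_double _))// natrD exprS.
  have -> : 4 - 2 * kap = 4 * q by rewrite /q; field.
  rewrite (_ : _ * _ * _ * _ = 4 * q * (q ^+ k * V 1 * (2 ^ k)%:R ^+ 2)); last by ring.
  by rewrite ler_wpM2l// mulr_ge0.
have [k0 Hk0] := geometric_small q01 (V0 1) eta0.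
exists k0 => k k0k; rewrite (le_trans (Vk k))// ler_wpM2r ?sqr_ge0//.
by rewrite mulrC Hk0.
Qed.

Lemma chebyshev_words n a : 0 < a ->
  \sum_(w <- words A n | a < `|wsum X w|) m w <= V n / a ^+ 2.
Proof.
move=> a0; rewrite ler_pdivlMr ?exprn_gt0// mulr_suml big_mkcond.
apply: ler_sum => w _; case: ifP => [aX|_]; last by rewrite mulr_ge0 ?sqr_ge0.
by rewrite ler_wpM2l// -[leRHS]real_normK ?num_real// ler_sqr ?nnegrE ?(ltW aX)// ltW.
Qed.

Lemma weak_law_prob a eta : 0 < a -> 0 < eta ->
  exists k0, forall k, (k0 <= k)%N ->
    \sum_(w <- words A (2 ^ k) | a * (2 ^ k)%:R < `|wsum X w|) m w <= eta.
Proof.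
move=> a0 eta0; have [|k0 Hk0] := @weak_law (eta * a ^+ 2).
  by rewrite mulr_gt0// exprn_gt0.
have n0 k : 0 < (2 ^ k)%:R :> R by rewrite ltr0n expn_gt0.
exists k0 => k /Hk0 Vk; rewrite (le_trans (chebyshev_words _ _))// ?mulr_gt0//.
by rewrite ler_pdivrMr ?exprn_gt0 ?mulr_gt0// exprMn mulrA.
Qed.

End lln.

(** * Powers and submultiplicative sequences *)

Lemma expr_unbounded {R : realType} (g B : R) : 1 < g ->
  exists n0, forall n, (n0 <= n)%N -> B <= g ^+ n.
Proof.
move=> g1.
have bern n : 1 + (g - 1) *+ n <= g ^+ n.
  elim: n => [|n IH]; first by rewrite mulr0n addr0 expr0.
  rewrite exprS; apply: le_trans (_ : g * (1 + (g - 1) *+ n) <= _); last first.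
    by rewrite ler_wpM2l// ltW// (lt_trans ltr01).
  rewrite -subr_ge0 mulrS; have : 0 <= (g - 1) * ((g - 1) *+ n).
    by rewrite mulr_ge0 ?mulrn_wge0// subr_ge0 ltW.
  by nra.
exists (Num.truncn (B / (g - 1))).+1 => n n0n.
apply: le_trans (bern n).
have : B / (g - 1) <= n%:R.
  by apply/ltW/(lt_le_trans (truncnS_gt _)); rewrite ler_nat.
by rewrite ler_pdivrMr ?subr_gt0// -mulr_natl => ?; lra.
Qed.

Lemma powR_lt1 {R : realType} (x s : R) : 0 < x < 1 -> 0 < s -> x `^ s < 1.
Proof.
move=> /andP[x0 x1] s0; have {1}<- : 1 `^ s = 1 :> R by rewrite powR1.
by rewrite gt0_ltr_powR// nnegrE ltW.
Qed.

Lemma powR_gt1 {R : realType} (x s : R) : 0 < x < 1 -> s < 0 -> 1 < x `^ s.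
Proof.
move=> x01 s0; rewrite -[s]opprK powRN invf_gt1 ?powR_lt1 ?oppr_gt0//.
by case/andP: x01 => x0 _; rewrite powR_gt0.
Qed.

(** Write k = j n + r with r < n: each of the j blocks of length n costs a factor at most 1/2, so q
    is the n-th root of 1/2. *)
Lemma submultiplicative_decay {R : realType} (f : nat -> R) (B : R) n :
  (forall k, 0 <= f k) -> (forall k, f (n + k)%N <= B * f n * f k) ->
  (0 < n)%N -> B * f n <= 2^-1 ->
  exists C q : R, [/\ 0 <= C, 0 < q < 1 & forall k, f k <= C * q ^+ k].
Proof.
move=> f0 fM n0 Bf; set q : R := 2^-1 `^ (n%:R^-1).
have q0 : 0 < q by rewrite powR_gt0.
have q1 : q < 1.
  by rewrite powR_lt1 ?invr_gt0 ?ltr0n// invf_lt1// ltr1n.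
have qn : q ^+ n = 2^-1.
  by rewrite -powR_mulrn ?ltW// -powRrM mulVf ?powRr1// ?pnatr_eq0 -?lt0n.
have fj j r : f (j * n + r)%N <= 2^-1 ^+ j * f r.
  elim: j => [|j IH]; first by rewrite mul1r.
  rewrite mulSn -addnA (le_trans (fM _))// exprS -[leRHS]mulrA.
  by rewrite (le_trans (ler_wpM2r _ Bf))// ler_wpM2l.
(* The sum bounds f at every remainder r, and the factor 2 makes up for q ^ r, which is at least q ^
   n = 1/2. *)
exists (2 * \sum_(r < n) f r), q; split; first by rewrite mulr_ge0// sumr_ge0.
  by rewrite q0.
move=> k; rewrite {1}(divn_eq k n) (le_trans (fj _ _))//.
have kn : (k %% n < n)%N by rewrite ltn_mod.
have fr : f (k %% n)%N <= \sum_(r < n) f r.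
  by rewrite (bigD1 (Ordinal kn))//= lerDl sumr_ge0.
rewrite -qn -exprM -mulrA [leRHS]mulrCA mulrC ler_pM ?exprn_ge0// ?(ltW q0)//.
rewrite [in leRHS](divn_eq k n) exprD mulrCA [(k %/ n * n)%N]mulnC.
rewrite ler_peMr ?exprn_ge0 ?(ltW q0)//.
by rewrite -ler_pdivrMl// mulr1 -qn ler_wiXn2l ?(ltW q0) ?(ltW q1) ?(ltnW kn).
Qed.

(* [m w] is the mass of the cylinder of [w] and [ell w] the length of the
   interval coded by [w]. *)
Record gibbs_weights (R : realType) (A : finType) (m ell : seq A -> R)
    (lo hi C c kap delta : R) : Prop := GibbsWeights {
  mass_ge0 : forall w, 0 <= m w;
  mass_nil : m [::] = 1;
  mass_rcons : forall w, \sum_i m (w ++ [:: i]) = m w;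
  mass_cons : forall w, \sum_i m (i :: w) = m w;
  mass_cat : forall u v, kap * (m u * m v) <= m (u ++ v);
  len_ge : forall w, lo ^+ size w <= ell w;
  len_le : forall w, ell w <= hi ^+ size w;
  len_cat_le : forall u v, ell (u ++ v) <= C * (ell u * ell v);
  len_cat_ge : forall u v, ell u * ell v <= C * ell (u ++ v);
  mass_le : forall w, m w <= c * ell w `^ delta;
  mass_ge : forall w, ell w `^ delta <= c * m w;
  weights_lo : 0 < lo;
  weights_hi : 0 < hi < 1;
  weights_C : 1 <= C;
  weights_c : 0 < c;
  weights_kap : 0 < kap;
  weights_delta : 0 < delta }.

(** * Sums of [ell ^ s] over words with bounded letter sum *)

Section pressure_drop.
Variables (R : realType) (A : finType) (m ell : seq A -> R).
Variables (lo hi C c kap delta : R).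
Hypothesis W : gibbs_weights m ell lo hi C c kap delta.
Let m_ge0 := mass_ge0 W.
Let m_nil := mass_nil W.
Let m_rcons := mass_rcons W.
Let m_cons := mass_cons W.
Let m_cat := mass_cat W.
Let ell_ge := len_ge W.
Let ell_le := len_le W.
Let ell_cat_le := len_cat_le W.
Let ell_cat_ge := len_cat_ge W.
Let m_le := mass_le W.
Let m_ge := mass_ge W.
Let lo_gt0 := weights_lo W.
Let hi_gt0 : 0 < hi. Proof. by case/andP: (weights_hi W). Qed.
Let hi_lt1 : hi < 1. Proof. by case/andP: (weights_hi W). Qed.
Let C_ge1 := weights_C W.
Let c_gt0 := weights_c W.
Let kap_gt0 := weights_kap W.
Let delta_gt0 := weights_delta W.
Implicit Types (X : A -> R) (s : R).

Lemma ell_gt0 w : 0 < ell w.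
Proof. by rewrite (lt_le_trans _ (ell_ge w))// exprn_gt0. Qed.
Hint Resolve ell_gt0 : core.

Lemma ell_ge0 w : 0 <= ell w. Proof. exact: ltW. Qed.
Hint Resolve ell_ge0 : core.

Lemma powR_split (x : R) s : 0 < x -> x `^ s = x `^ delta * x `^ (s - delta).
Proof.
move=> x0; rewrite -powRD ?(gt_eqF x0) ?implybT//.
by rewrite addrCA subrr addr0.
Qed.

(** Split off [ell ^ delta], which is at most [c * m] and so has total at most c; the remaining
    power s - delta is positive and decays geometrically with the length. *)
Lemma sum_ell_supercritical s : delta < s ->
  exists q : R, 0 < q < 1 /\ forall n, \sum_(w <- words A n) ell w `^ s <= c * q ^+ n.
Proof.
move=> ds; exists (hi `^ (s - delta)); split.
  by rewrite powR_gt0//= powR_lt1 ?hi_gt0 ?subr_gt0.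
move=> n; rewrite -[leRHS]mulr1 -(sum_words m_nil m_rcons n) mulr_sumr.
apply: ler_words_size => w wn; rewrite powR_split// mulrAC.
rewrite ler_pM ?powR_ge0//.
rewrite -powR_mulrn ?powR_ge0// powRAC ge0_ler_powR ?nnegrE ?subr_ge0 ?(ltW ds) ?powR_ge0//.
by rewrite powR_mulrn ?(ltW hi_gt0)// -wn.
Qed.

Lemma letter_gt0 i : 0 < m [:: i].
Proof.
rewrite -(pmulr_rgt0 _ c_gt0); apply: lt_le_trans (m_ge _).
by rewrite powR_gt0.
Qed.

(** Every letter has positive mass, so a function of mean 0 that is not identically 0 takes both
    signs; [x0] is the smaller of the two sizes found. *)
Lemma mean0_signs X : \sum_i m [:: i] * X i = 0 ->
  (exists x0 a b, [/\ 0 < x0, X a <= - x0 & x0 <= X b]) \/ forall i, X i = 0.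
Proof.
move=> X0; have [allX|nX] := pselect (forall i, X i = 0); [by right|left].
have ex (Y : A -> R) : \sum_i m [:: i] * Y i = 0 -> ~ (forall i, Y i = 0) -> exists b, 0 < Y b.
  move=> Y0 nY; apply: contrapT => /forallNP np; apply: nY => i.
  have Yle j : 0 <= m [:: j] * - Y j.
    by rewrite mulr_ge0 ?m_ge0// oppr_ge0 leNgt; apply/negP/np.
  have /eqP : \sum_i m [:: i] * - Y i = 0.
    by under eq_bigr do rewrite mulrN; rewrite sumrN Y0 oppr0.
  rewrite psumr_eq0// => /allP/(_ i (mem_index_enum i))/=.
  by rewrite mulf_eq0 (gt_eqF (letter_gt0 i))/= oppr_eq0 => /eqP.
have [b Xb] := ex X X0 nX.
have [||a Xa] := ex (fun i => - X i).
- by under eq_bigr do rewrite mulrN; rewrite sumrN X0 oppr0.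
- by move=> h; apply: nX => i; apply/eqP; rewrite -oppr_eq0 h.
exists (Order.min (- X a) (X b)), a, b; split.
- by rewrite lt_min Xa.
- by rewrite lerNr ge_min lexx.
- by rewrite ge_min lexx orbT.
Qed.

(** Greedy correction: append [b] when the running sum is at most 0 and [a] otherwise. Each letter
    lowers the excess over M by at least [x0], and a sum within M never leaves that range. The
    offset [s0] is the sum already accumulated at a node of the tree built later. *)
Lemma correction_word X M : (forall i, `|X i| <= M) -> \sum_i m [:: i] * X i = 0 ->
  exists2 x0, 0 < x0 & forall (t : nat) w s0, `|s0| <= M -> `|wsum X w| <= x0 * t%:R ->
    exists2 v, size v = t & `|s0 + wsum X (w ++ v)| <= M.
Proof.
move=> XM /mean0_signs[[x0 [a [b [x00 Xa Xb]]]]|X0].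
  exists x0 => // t w s0 s0M wt.
  suff H s1 : `|s1| <= M + x0 * t%:R -> exists2 v, size v = t & `|s1 + wsum X v| <= M.
    have [|v vt sv] := H (s0 + wsum X w); first by rewrite (le_trans (ler_normD _ _))// lerD.
    by exists v => //; rewrite wsum_cat addrA.
  elim: t s1 {wt} => [|t IH] s1.
    by rewrite mulr0 addr0 => s1M; exists [::] => //; rewrite wsum_nil addr0.
  rewrite -natr1 mulrDr mulr1 ler_norml => /andP[l1 l2].
  have xt : 0 <= x0 * t%:R by rewrite mulr_ge0// ltW.
  have [s10|s10] := leP s1 0.
    have [|v vt sv] := IH (s1 + X b).
      have := XM b; rewrite !ler_norml => /andP[? ?]; lra.
    by exists (b :: v); rewrite /= ?vt// wsum_cons addrA.
  have [|v vt sv] := IH (s1 + X a).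
    have := XM a; rewrite !ler_norml => /andP[? ?]; lra.
  by exists (a :: v); rewrite /= ?vt// wsum_cons addrA.
(* Here X vanishes, so any word of length t will do; a letter exists because the letters have total
   mass 1. *)
exists 1 => // t w s0 s0M _.
have [i _] : exists i : A, True.
  apply: contrapT => /forallNP nA; have := m_rcons [::].
  rewrite m_nil big1 => [/eqP|i]; first by rewrite eq_sym oner_eq0.
  by case: (nA i).
exists (nseq t i); first by rewrite size_nseq.
by rewrite /wsum big1 ?addr0.
Qed.

(** For each u in Q keep a single extension [u ++ v] in P and drop the other, nonnegative, terms. *)
Lemma sum_words_append n t (P Q : pred (seq A)) (f : seq A -> R) :
  (forall w, 0 <= f w) ->
  (forall u, size u = n -> Q u -> exists2 v, size v = t & P (u ++ v)) ->
  forall b, (forall u v, size u = n -> size v = t -> b u <= f (u ++ v)) ->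
  \sum_(u <- words A n | Q u) b u <= \sum_(w <- words A (n + t) | P w) f w.
Proof.
move=> f0 QP b bf; rewrite big_mkcond [leRHS]big_mkcond big_wordsD.
apply: ler_words_size => u un; case: ifPn => [/(QP u un)[v vt Puv]|_]; last first.
  by apply: sumr_ge0 => v _; case: ifP.
rewrite (bigD1_seq v) ?words_uniq ?mem_words ?vt//= Puv.
by rewrite (le_trans (bf u v _ _))// lerDl sumr_ge0// => ? _; case: ifP.
Qed.

(* The good words have length [D * t]; a correction of length [t] costs a factor
   [lo ^ (s * t)], up to a constant, and [D] is chosen so that the gain
   [hi ^ ((s - delta) * D * t)] outweighs it. *)
Lemma near_words_unbounded X M s : (forall i, `|X i| <= M) ->
  \sum_i m [:: i] * X i = 0 -> 0 <= s < delta ->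
  forall B, exists2 N, (0 < N)%N & forall s0, `|s0| <= M ->
    B <= \sum_(w <- words A N | `|s0 + wsum X w| <= M) ell w `^ s.
Proof.
move=> XM X0 /andP[s0 sd] B.
have [x0 x00 corr] := correction_word XM X0.
set g := hi `^ (s - delta).
have g1 : 1 < g.
  by rewrite powR_gt1 ?hi_gt0 ?subr_lt0.
have g0 : 0 <= g by rewrite powR_ge0.
have los : 0 < lo `^ s by rewrite powR_gt0.
have [j0 Hj] := expr_unbounded (2 / lo `^ s) g1.
(* D, t and n = D t are powers of 2, since the weak law is available only along these lengths. *)
pose D := (2 ^ j0)%N.
have DR : 0 < D%:R :> R by rewrite ltr0n expn_gt0.
have gD : 2 <= lo `^ s * g ^+ D.
  by rewrite -ler_pdivrMl// mulrC Hj// ltnW// ltn_expl.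
have Cs : 0 < C `^ s by rewrite powR_gt0// (lt_le_trans ltr01).
(* The losses: [C ^ s] for splitting the length of a concatenation, c for passing from mass to
   [ell ^ delta], and 1/2 because only half of the mass is known to be good. *)
set K := (C `^ s)^-1 * c^-1 / 2.
have K0 : 0 < K by rewrite !mulr_gt0// ?invr_gt0.
have [l1 Hl] : exists n0, forall n, (n0 <= n)%N -> B / K <= 2 ^+ n.
  by apply: expr_unbounded; rewrite ltr1n.
have [k0 Hk] : exists k0, forall k, (k0 <= k)%N ->
    \sum_(w <- words A (2 ^ k) | x0 / D%:R * (2 ^ k)%:R < `|wsum X w|) m w <= 2^-1.
  by apply: (weak_law_prob m_ge0 m_nil m_rcons m_cons kap_gt0 m_cat X0); rewrite // divr_gt0.
pose t := (2 ^ (maxn l1 k0))%N.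
have tl : (l1 <= t)%N by rewrite (leq_trans (leq_maxl l1 k0))// ltnW// ltn_expl.
pose n := (2 ^ (j0 + maxn l1 k0))%N.
have nE : n = (D * t)%N by rewrite /n expnD.
exists (n + t)%N; first by rewrite addn_gt0 expn_gt0.
move=> y yM.
(* The allowed deviation [x0 / D * n] equals [x0 * t], exactly what t letters can correct. *)
pose Q w := `|wsum X w| <= x0 / D%:R * n%:R.
have Qm : 2^-1 <= \sum_(w <- words A n | Q w) m w.
  have := Hk (j0 + maxn l1 k0)%N; rewrite (leq_trans (leq_maxr l1 k0) (leq_addl _ _)).
  move=> /(_ isT) Hn; have := sum_words m_nil m_rcons n.
  rewrite (bigID Q)/= => tot; rewrite -(lerD2r (\sum_(w <- words A n | ~~ Q w) m w)).
  rewrite tot.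
  have -> : \sum_(w <- words A n | ~~ Q w) m w =
     \sum_(w <- words A n | x0 / D%:R * n%:R < `|wsum X w|) m w.
    by apply: eq_bigl => w; rewrite /Q -ltNge.
  rewrite (le_trans (lerD (lexx _) Hn))//; lra.
apply: le_trans (_ : \sum_(w <- words A n | Q w) (K * 2) * (lo `^ s * g ^+ D) ^+ t * m w <= _).
  rewrite -mulr_sumr; apply: le_trans (_ : K * (lo `^ s * g ^+ D) ^+ t <= _); last first.
    rewrite -mulrA -mulrA ler_wpM2l ?(ltW K0)// mulrCA ler_peMr//.
      by rewrite exprn_ge0// mulr_ge0 ?exprn_ge0 ?powR_ge0.
    by rewrite -ler_pdivrMl// mulr1.
  rewrite -ler_pdivrMl// mulrC (le_trans (Hl t tl))//.
  by rewrite lerXn2r ?nnegrE// mulr_ge0 ?exprn_ge0 ?powR_ge0.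
apply: sum_words_append => [w|u un Qu|u v un vt]; first exact: powR_ge0.
  apply: corr => //; rewrite (le_trans Qu)// nE natrM.
  by rewrite mulrA divfK// gt_eqF.
apply: le_trans (_ : (C^-1 * (ell u * lo ^+ t)) `^ s <= _); last first.
  rewrite ge0_ler_powR ?nnegrE// ?mulr_ge0 ?invr_ge0 ?exprn_ge0 ?(ltW lo_gt0)//.
    by rewrite (le_trans ler01).
  rewrite ler_pdivrMl ?(lt_le_trans ltr01)// (le_trans _ (ell_cat_ge _ _))//.
  by rewrite ler_wpM2l// -vt.
rewrite powRM ?mulr_ge0 ?invr_ge0 ?exprn_ge0 ?(ltW lo_gt0)//; last by rewrite (le_trans ler01).
rewrite powRM ?exprn_ge0 ?(ltW lo_gt0)//.
have -> : (lo ^+ t) `^ s = (lo `^ s) ^+ t.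
  by rewrite -powR_mulrn ?(ltW lo_gt0)// powRAC powR_mulrn ?powR_ge0.
have -> : C^-1 `^ s = (C `^ s)^-1.
  by rewrite -powR_inv1 ?(le_trans ler01)// powRAC powR_inv1 ?powR_ge0.
rewrite /K exprMn -exprM -nE.
have -> : (C `^ s)^-1 * c^-1 / 2 * 2 * (lo `^ s ^+ t * g ^+ n) * m u =
  (C `^ s)^-1 * ((c^-1 * m u * g ^+ n) * lo `^ s ^+ t) by field; rewrite !gt_eqF.
rewrite ler_wpM2l ?invr_ge0 ?(ltW Cs)// ler_wpM2r ?exprn_ge0 ?(ltW los)//.
rewrite powR_split// ler_pM ?exprn_ge0//.
- by rewrite mulr_ge0// invr_ge0 ltW.
- by rewrite ler_pdivrMl.
rewrite /g -powR_mulrn ?powR_ge0// powRAC powR_mulrn ?(ltW hi_gt0)//.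
rewrite -[s - delta]opprB !powRN lef_pV2 ?posrE ?powR_gt0 ?exprn_gt0//.
by rewrite ge0_ler_powR ?nnegrE ?exprn_ge0 ?(ltW hi_gt0) ?subr_ge0 ?(ltW sd)// -un.
Qed.

(** The constant [C ^ delta] serves all s in [0, delta] at once, so it can be fixed before s is
    chosen. *)
Lemma powR_cat_le s : 0 <= s <= delta -> forall u v,
  ell (u ++ v) `^ s <= C `^ delta * (ell u `^ s * ell v `^ s).
Proof.
move=> /andP[s0 sd] u v; have C0 := le_trans ler01 C_ge1.
apply: le_trans (_ : (C * (ell u * ell v)) `^ s <= _).
  by rewrite ge0_ler_powR ?nnegrE ?mulr_ge0.
rewrite !powRM ?mulr_ge0// ler_wpM2r ?mulr_ge0 ?powR_ge0//.
exact: ler_powR.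
Qed.

(* By the weak law the exponential moment is small at one length [n]; then [s] is
   chosen close enough to [delta], and submultiplicativity gives the decay. *)
Lemma expR_wsum_decay X : 0 < \sum_i m [:: i] * X i ->
  exists s tau, [/\ 0 <= s < delta, 0 < tau & exists C' q : R,
    [/\ 0 <= C', 0 < q < 1 & forall n,
      \sum_(w <- words A n) ell w `^ s * expR (- (tau * wsum X w)) <= C' * q ^+ n]].
Proof.
set a := \sum_i _ => a0.
have [M M0 XM] := finite_bound X.
have Y0 : \sum_i m [:: i] * (X i - a) = 0.
  under eq_bigr do rewrite mulrBr.
  rewrite sumrB -mulr_suml -/a.
  have := m_rcons [::]; rewrite m_nil /= => ->; rewrite mul1r subrr//.
(* The constant of submultiplicativity times the cost of replacing [ell ^ delta] by the mass. *)
pose B := C `^ delta * c.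
have B0 : 0 < B by rewrite mulr_gt0// powR_gt0// (lt_le_trans ltr01).
(* T will be [tau * n]. Words whose sum is at least a n / 2 contribute at most
   [B * expR (- (T * (a / 2)))], hence at most 1/8. *)
have [T T0 TB] : exists2 T : R, 0 < T & B * expR (- (T * (a / 2))) <= 8^-1.
  exists ((8 * B) / (a / 2)); first by apply: divr_gt0; [exact: mulr_gt0|exact: divr_gt0].
  rewrite divfK ?gt_eqF ?divr_gt0// expRN ler_pdivrMr ?expR_gt0//.
  rewrite -ler_pdivrMl ?invr_gt0// invrK.
  by rewrite (le_trans _ (expR_ge1Dx _))// lerDr.
(* The mass left to the exceptional words: their exponential weight is at most [expR (T * M)], so
   they contribute at most another 1/8. *)
pose eta := 8^-1 / B * expR (- (T * M)).
have eta0 : 0 < eta by rewrite mulr_gt0 ?expR_gt0// divr_gt0.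
have a20 : 0 < a / 2 by rewrite divr_gt0.
have [k0 Hk] := weak_law_prob m_ge0 m_nil m_rcons m_cons kap_gt0 m_cat Y0 a20 eta0.
have {Hk} := Hk _ (leqnn k0); set n := (2 ^ k0)%N => Hk.
have n0 : (0 < n)%N by rewrite expn_gt0.
have nR : 0 < n%:R :> R by rewrite ltr0n.
pose tau := T / n%:R.
have tau0 : 0 < tau by rewrite divr_gt0.
have tauM : tau * (M *+ n) = T * M.
  by rewrite -mulr_natl /tau mulrA divfK ?gt_eqF.
have Zd : C `^ delta * \sum_(w <- words A n) ell w `^ delta * expR (- (tau * wsum X w)) <= 4^-1.
  apply: le_trans (_ : B * (\sum_(w <- words A n) m w * expR (- (T * (a / 2))) +
     \sum_(w <- words A n | a / 2 * n%:R < `|wsum (fun i => X i - a) w|) m w * expR (T * M)) <= _).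
    rewrite /B -[leRHS]mulrA ler_wpM2l ?powR_ge0// mulrDr !mulr_sumr [X in _ <= _ + X]big_mkcond -big_split/=.
    apply: ler_words_size => w wn.
    case: ifPn => [_|]; last first.
      rewrite -leNgt wsumB wn => Xw; rewrite addr0 mulrA ler_pM ?powR_ge0 ?expR_ge0 ?m_ge//.
      rewrite ler_expR lerN2 /tau mulrAC -[leRHS]mulrA ler_wpM2l ?(ltW T0)//.
      rewrite ler_pdivlMr//; move: Xw; rewrite ler_norml => /andP[+ _]; lra.
    rewrite -[leLHS]add0r lerD ?mulr_ge0 ?expR_ge0// ?(ltW c_gt0)// mulrA.
    rewrite ler_pM ?powR_ge0 ?expR_ge0 ?m_ge//.
    rewrite ler_expR -tauM -mulrN ler_wpM2l ?(ltW tau0)//.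
    by have := wsum_norm_le w XM; rewrite wn ler_norml => /andP[+ _]; rewrite lerNl.
  rewrite -!mulr_suml sum_words// mul1r mulrDr.
  have := ler_wpM2r (expR_ge0 (T * M)) Hk.
  rewrite /eta -[leRHS]mulrA -expRD addNr expR0 mulr1 => /(ler_wpM2l (ltW B0)).
  rewrite [leRHS]mulrCA divff ?gt_eqF// mulr1 => h.
  by rewrite (le_trans (lerD TB h))//; lra.
(* Lowering the exponent from delta to delta - th multiplies each term of length n by at most
   [(lo ^ n) ^ (- th)]. A bound of 2 here turns 1/4 into the 1/2 required by
   [submultiplicative_decay]. *)
have [th /andP[th0 thd] thlo] : exists2 th, 0 < th <= delta & (lo ^+ n) `^ (- th) <= 2.
  pose L := - ln (lo ^+ n).
  exists (Order.min delta (1 / 2 / (`|L| + 1))).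
    by rewrite lt_min delta_gt0 ge_min lexx/= !divr_gt0// ltr_wpDl.
  set th := Order.min _ _.
  have : th <= 1 / 2 / (`|L| + 1) by rewrite ge_min lexx orbT.
  rewrite ler_pdivlMr ?ltr_wpDl// => thL.
  have th0 : 0 < th by rewrite lt_min delta_gt0 !divr_gt0// ltr_wpDl.
  rewrite /powR gt_eqF ?exprn_gt0// mulNr -mulrN -/L.
  have tL : th * L <= 1 / 2.
    apply: le_trans thL; rewrite ler_wpM2l ?(ltW th0)//.
    by rewrite (le_trans (ler_norm _))// lerDl.
  have := expR_ge1Dx (- (th * L)); rewrite expRN.
  have e0 : 0 < expR (th * L) by rewrite expR_gt0.
  by move=> h; rewrite -lef_pV2 ?posrE//; lra.
exists (delta - th), tau; split=> //.
  by rewrite subr_ge0 thd ltrBlDr ltrDl.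
apply: (@submultiplicative_decay _ _ (C `^ delta) n) => //.
- by move=> k; apply: sumr_ge0 => w _; rewrite mulr_ge0 ?powR_ge0 ?expR_ge0.
- move=> k; rewrite big_wordsD -mulrA mulr_suml mulr_sumr; apply: ler_sum => u _.
  rewrite mulr_sumr mulr_sumr; apply: ler_sum => v _.
  rewrite wsum_cat mulrDr opprD expRD.
  rewrite (_ : _ * (_ * (_ * _)) = C `^ delta * (ell u `^ (delta - th) * ell v `^ (delta - th)) *
    (expR (- (tau * wsum X u)) * expR (- (tau * wsum X v)))); last by ring.
  rewrite ler_wpM2r ?mulr_ge0 ?expR_ge0// powR_cat_le// subr_ge0 thd/=.
  by rewrite lerBlDr lerDl ltW.
apply: le_trans (_ : 2 * 4^-1 <= _); last by lra.
apply: le_trans (ler_wpM2l _ Zd); rewrite // mulrCA ler_wpM2l ?powR_ge0// mulr_sumr.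
apply: ler_words_size => w wn; rewrite mulrA ler_wpM2r ?expR_ge0//.
rewrite powR_split// mulrC ler_wpM2r ?powR_ge0//.
rewrite (_ : delta - th - delta = - th); last by ring.
apply: le_trans thlo; rewrite !powRN lef_pV2 ?posrE ?powR_gt0 ?exprn_gt0//.
by rewrite ge0_ler_powR ?nnegrE ?exprn_ge0 ?(ltW lo_gt0) ?(ltW th0)// -wn.
Qed.

(** On words with letter sum at most K the exponential weight is at least [expR (- (tau * K))], so
    the restricted sum is dominated by the exponential moment. *)
Lemma near_words_decay_pos X : 0 < \sum_i m [:: i] * X i ->
  exists2 s, 0 <= s < delta & forall K, exists C' q : R,
    [/\ 0 <= C', 0 < q < 1 & forall n,
      \sum_(w <- words A n | `|wsum X w| <= K) ell w `^ s <= C' * q ^+ n].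
Proof.
move=> /expR_wsum_decay[s [tau [s0 tau0 [C' [q [C'0 q01 decay]]]]]].
exists s => // K; exists (expR (tau * K) * C'), q; split => //.
  by rewrite mulr_ge0 ?expR_ge0.
move=> n; rewrite -mulrA -ler_pdivrMl ?expR_gt0// -expRN mulrC (le_trans _ (decay n))//.
rewrite mulr_suml big_mkcond; apply: ler_sum => w _; case: ifP => [wK|_]; last first.
  by rewrite mulr_ge0 ?powR_ge0 ?expR_ge0.
rewrite ler_wpM2l ?powR_ge0// ler_expR lerN2 ler_wpM2l ?(ltW tau0)//.
by rewrite (le_trans (ler_norm _)).
Qed.

Lemma near_words_decay X : \sum_i m [:: i] * X i != 0 ->
  exists2 s, 0 <= s < delta & forall K, exists C' q : R,
    [/\ 0 <= C', 0 < q < 1 & forall n,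
      \sum_(w <- words A n | `|wsum X w| <= K) ell w `^ s <= C' * q ^+ n].
Proof.
rewrite neq_lt => /orP[X0|]; last exact: near_words_decay_pos.
have [|s s0 H] := @near_words_decay_pos (fun i => - X i).
  by under eq_bigr do rewrite mulrN; rewrite sumrN oppr_gt0.
exists s => // K; have [C' [q [C'0 q01 decay]]] := H K.
exists C', q; split => // n; apply: le_trans (decay n).
by under [leRHS]eq_bigl do rewrite wsumN normrN.
Qed.

End pressure_drop.

(** * Hausdorff null sets *)

Section hausdorff_null.
Context {R : realType}.
Implicit Types (U E : set R) (s r : R).

Lemma diam_le U (d : R) : (forall x y, U x -> U y -> `|x - y| <= d) -> (diam U <= d%:E)%E.
Proof.
by move=> Ud; apply: ge_ereal_sup => _ [[x y] [/= Ux Uy] <-]; rewrite lee_fin Ud.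
Qed.

Lemma diam_ge U x y : U x -> U y -> (`|x - y|%:E <= diam U)%E.
Proof. by move=> Ux Uy; apply: ereal_sup_ubound; exists (x, y). Qed.

Lemma diam_ge0 U : U !=set0 -> (0 <= diam U)%E.
Proof. by move=> [x Ux]; apply: le_trans (diam_ge Ux Ux); rewrite lee_fin. Qed.

Lemma diam_set0 : diam (set0 : set R) = -oo%E.
Proof.
rewrite /diam (_ : [set _ | _ in _] = set0) ?ereal_sup0//.
by rewrite -subset0 => _ [[x y] [/= []]].
Qed.

Lemma diam_pow_ge0 s U : (0 <= diam_pow s U)%E.
Proof. by rewrite /diam_pow; case: ifP => // _; exact: poweR_ge0. Qed.

Lemma diam_pow_set0 s : diam_pow s (set0 : set R) = 0%E.
Proof. by rewrite /diam_pow eqxx. Qed.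

Lemma diam_pow_le s U (d : R) : 0 <= s ->
  (diam U <= d%:E)%E -> (diam_pow s U <= (d `^ s)%:E)%E.
Proof.
move=> s0 dU; rewrite /diam_pow; case: ifPn => [_|/set0P U0].
  by rewrite lee_fin powR_ge0.
rewrite -poweR_EFin gt0_ler_poweR// in_itv/= ?leey ?andbT ?diam_ge0//.
by rewrite (le_trans (diam_ge0 U0)).
Qed.

Lemma diam_pow_mono s t U : 0 <= s <= t -> (diam U <= 1)%E ->
  (diam_pow t U <= diam_pow s U)%E.
Proof.
move=> /andP[s0 st]; rewrite /diam_pow; case: ifPn => // /set0P U0.
have := diam_ge0 U0; case: (diam U) => //= d.
rewrite !lee_fin le_eqVlt => /orP[/eqP<- _|d0 d1]; last by rewrite ger_powR// d0.
(* A set of diameter 0 needs care because 0 ^ 0 = 1; t = 0 forces s = 0. *)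
have [t0|t0] := eqVneq t 0; last by rewrite powR0// powR_ge0.
by rewrite t0 (_ : s = 0)//; apply/eqP; rewrite eq_le s0 -t0 st.
Qed.

(** Vanishing of the s-dimensional measure, stated through explicit covers so that unions and limit
    sets can be handled directly. *)
Definition hausdorff_null s E := forall r e, 0 < r -> 0 < e ->
  exists U : nat -> set R, [/\ forall i, (diam (U i) <= r%:E)%E,
    E `<=` \bigcup_i U i & (\sum_(0 <= i <oo) diam_pow s (U i) <= e%:E)%E].

Lemma nneseries_diam_pow_ge0 s (U : nat -> set R) : (0 <= \sum_(0 <= i <oo) diam_pow s (U i))%E.
Proof. by apply: nneseries_ge0 => i _ _; exact: diam_pow_ge0. Qed.

Lemma hausdorff_nullP s E : hausdorff_measure s E = 0%E <-> hausdorff_null s E.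
Proof.
have pre0 r : (0 <= hausdorff_premeasure s r E)%E.
  by apply: le_ereal_inf_tmp => _ [U _ <-]; exact: nneseries_diam_pow_ge0.
split=> [H0 r e r0 e0|Hn].
  have : (hausdorff_premeasure s r E < e%:E)%E.
    have : (hausdorff_premeasure s r E <= 0)%E.
      by rewrite -H0; apply: ereal_sup_ubound; exists r.
    by move/le_lt_trans; apply; rewrite lte_fin.
  by move=> /ereal_inf_lt[_ [U [dU EU] <-] Ue]; exists U; split => //; exact: ltW.
apply/eqP; rewrite eq_le; apply/andP; split; last first.
  by apply: le_trans (pre0 1) _; apply: ereal_sup_ubound; exists 1 => //=.
apply: ge_ereal_sup => _ [r r0 <-]; apply/lee_addgt0Pr => e e0; rewrite add0e.
have [U [dU EU Ue]] := Hn r e r0 e0.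
by apply: le_trans Ue; apply: ereal_inf_lbound; exists U.
Qed.

Lemma hausdorff_null_sub s E E' : E `<=` E' -> hausdorff_null s E' -> hausdorff_null s E.
Proof.
move=> EE' H r e r0 e0; have [U [dU EU Ue]] := H r e r0 e0.
by exists U; split => //; exact: subset_trans EU.
Qed.

Lemma hausdorff_null_mono s t E : 0 <= s <= t -> hausdorff_null s E -> hausdorff_null t E.
Proof.
move=> st H r e r0 e0; have r10 : 0 < Num.min r 1 by rewrite lt_min r0 ltr01.
have [U [dU EU Ue]] := H _ e r10 e0.
exists U; split=> //; first by move=> i; rewrite (le_trans (dU i))// lee_fin ge_min lexx.
apply: le_trans Ue; apply: lee_nneseries => [i _ _|i _]; first exact: diam_pow_ge0.
apply: diam_pow_mono => //; rewrite (le_trans (dU i))// lee_fin ge_min lexx orbT//.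
Qed.

(** Allows covers indexed by words or by pairs; natural numbers that encode no index receive the
    empty set, of weight 0. *)
Lemma hausdorff_null_countType (I : countType) s E :
  (forall r e, 0 < r -> 0 < e -> exists U : I -> set R,
    [/\ forall i, (diam (U i) <= r%:E)%E, E `<=` \bigcup_i U i &
       (\esum_(i in [set: I]) diam_pow s (U i) <= e%:E)%E]) ->
  hausdorff_null s E.
Proof.
move=> H r e r0 e0; have [U [dU EU Ue]] := H r e r0 e0.
pose V n := if pickle_inv n is Some i then U i else set0.
have VU i : V (pickle i) = U i by rewrite /V pickleK_inv.
exists V; split.
- by move=> n; rewrite /V; case: pickle_inv => // *; rewrite diam_set0 leNye.
- by move=> x /EU[i _ Ui]; exists (pickle i) => //; rewrite VU.
apply: le_trans Ue; rewrite nneseries_esumT; last by move=> n; exact: diam_pow_ge0.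
rewrite (eq_esum (b := fun n => if n \in range (@pickle I) then diam_pow s (V n) else 0%E)); last first.
  move=> n _; case: ifPn => // /negP; rewrite inE => nr; rewrite /V.
  case E1 : (pickle_inv n) => [i|]; last by rewrite diam_pow_set0.
  by case: nr; exists i => //; have := @pickle_invK I n; rewrite E1.
rewrite -esum_mkcond esum_image; last first.
  by move=> i j _ _; exact: (pcan_inj (@pickleK I)).
by apply: le_esum => i _; rewrite VU.
Qed.

Lemma hausdorff_null_bigcup (I : countType) s (E : I -> set R) :
  (forall i, hausdorff_null s (E i)) -> hausdorff_null s (\bigcup_i E i).
Proof.
move=> H.
pose E' n := if pickle_inv n is Some i then E i else set0.
have H' n : hausdorff_null s (E' n).
  rewrite /E'; case: pickle_inv => // r e r0 e0; exists (fun=> set0); split=> //.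
    by move=> _; rewrite diam_set0 leNye.
  by rewrite eseries0 ?lee_fin ?(ltW e0)// => *; rewrite diam_pow_set0.
apply: (@hausdorff_null_sub _ _ (\bigcup_n E' n)).
  by move=> x [i _ Ei]; exists (pickle i) => //; rewrite /E' pickleK_inv.
apply: (@hausdorff_null_countType (nat * nat)%type) => r e r0 e0.
have e2 n : 0 < e / (2 ^ n.+1)%:R by rewrite divr_gt0// ltr0n expn_gt0.
have /choice[U HU] n := H' n r _ r0 (e2 n).
exists (fun p => U p.1 p.2); split.
- by move=> [n i] /=; have [+ _ _] := HU n.
- move=> x [n _ Ex]; have [_ EU _] := HU n.
  by have [i _ Ui] := EU _ Ex; exists (n, i).
have -> : [set: nat * nat] = [set: nat] `*`` (fun=> [set: nat]).
  by apply/seteqP; split.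
rewrite -(esum_esum (a := fun n i => diam_pow s (U n i))); last by move=> *; exact: diam_pow_ge0.
apply: le_trans (epsilon_trick0 xpredT (ltW e0)).
rewrite nneseries_esumT; last by move=> n; rewrite lee_fin ltW.
apply: le_esum => n _; rewrite -nneseries_esumT; last by move=> *; exact: diam_pow_ge0.
by have [_ _] := HU n.
Qed.

Lemma hausdorff_null_set1 s x : 0 < s -> hausdorff_null s [set x].
Proof.
move=> s0; apply: (@hausdorff_null_countType unit) => r e r0 e0.
have d0 : (diam [set x] <= 0%:E)%E by apply: diam_le => _ _ -> ->; rewrite subrr normr0.
exists (fun=> [set x]); split=> [i|y ->|].
- by rewrite (le_trans d0)// lee_fin ltW.
- by exists tt.
rewrite esum1 ?lee_fin ?(ltW e0)// => _ _; apply/eqP; rewrite eq_le diam_pow_ge0 andbT.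
by rewrite (le_trans (diam_pow_le (ltW s0) d0))// powR0 ?gt_eqF.
Qed.

Lemma hausdorff_dim_le s E : 0 <= s -> hausdorff_null s E -> (hausdorff_dim E <= s%:E)%E.
Proof.
by move=> s0 /hausdorff_nullP H; apply: ereal_inf_lbound; exists s.
Qed.

Lemma hausdorff_dim_ge s E : (forall t, 0 <= t -> hausdorff_null t E -> s <= t) ->
  (s%:E <= hausdorff_dim E)%E.
Proof.
move=> H; apply: le_ereal_inf_tmp => _ [t [t0 /hausdorff_nullP Ht] <-].
by rewrite lee_fin H.
Qed.

Lemma hausdorff_dim_mono E E' : E `<=` E' -> (hausdorff_dim E <= hausdorff_dim E')%E.
Proof.
move=> EE'; apply: le_ereal_inf_tmp => _ [t [t0 /hausdorff_nullP Ht] <-].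
by apply: hausdorff_dim_le => //; exact: hausdorff_null_sub Ht.
Qed.

End hausdorff_null.

(** * Covers of limsup sets *)

Section limsup.
Context {R : realType} {A : finType}.

Lemma geometric_partial_sum (q : R) N k : 0 < q < 1 ->
  \sum_(N <= n < k) q ^+ n <= q ^+ N / (1 - q).
Proof.
move=> /andP[q0 q1]; have q1' : 0 < 1 - q by rewrite subr_gt0.
have [kN|/ltnW Nk] := leqP k N.
  by rewrite big_geq// divr_ge0 ?exprn_ge0// ltW.
rewrite ler_pdivlMr// mulr_suml.
under eq_bigr do rewrite mulrBr mulr1 -exprSr -opprB.
by rewrite sumrN telescope_sumr// opprB lerBlDr lerDl exprn_ge0// ltW.
Qed.

(** A finite subfamily is regrouped by word length, and each length contributes at most one term of
    the geometric series. *)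
Lemma esum_words_geometric (P : pred (seq A)) (f : seq A -> R) (C q : R) N :
  (forall w, 0 <= f w) -> 0 <= C -> 0 < q < 1 ->
  (forall n, \sum_(w <- words A n | P w) f w <= C * q ^+ n) ->
  (\esum_(w in [set w | P w /\ (N <= size w)%N]) (f w)%:E <= (C * (q ^+ N / (1 - q)))%:E)%E.
Proof.
move=> f0 C0 q01 H; apply: ge_ereal_sup => _ [X [finX XS] <-].
have [s0 Xs0] := (finite_seqP _).1 finX; pose r := undup s0.
have ru : uniq r := undup_uniq s0.
have Xr : X = [set` r] by apply/seteqP; split=> w; rewrite /= mem_undup Xs0.
rewrite Xr -fsbig_seq//= sumEFin lee_fin.
have rX w : w \in r -> P w /\ (N <= size w)%N by move=> wr; apply: XS; rewrite Xr.
pose k := (\max_(w <- r) size w).+1.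
apply: le_trans (_ : \sum_(N <= n < k) C * q ^+ n <= _); last first.
  by rewrite -mulr_sumr ler_wpM2l// geometric_partial_sum.
apply: le_trans (_ : \sum_(N <= n < k) \sum_(w <- words A n | P w) f w <= _); last first.
  by apply: ler_sum.
apply: le_trans (_ : \sum_(N <= n < k) \sum_(w <- r | size w == n) f w <= _).
  rewrite (exchange_big_dep xpredT)//= big_seq [leRHS]big_seq ler_sum// => w wr.
  rewrite big_mkcond (bigD1_seq (size w))/= ?iota_uniq// ?eqxx.
    by rewrite lerDl sumr_ge0// => n _; case: ifP.
  rewrite mem_index_iota ltnS (rX w wr).2/=.
  by rewrite (@leq_bigmax_seq _ _ xpredT).
apply: ler_sum => n _.
apply: le_trans (_ : \sum_(w <- words A n | w \in r) f w <= _).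
  rewrite -big_filter -[leRHS]big_filter le_eqVlt; apply/orP; left; apply/eqP.
  apply: perm_big; apply: uniq_perm; rewrite ?filter_uniq ?words_uniq// => w.
  by rewrite !mem_filter mem_words andbC.
rewrite big_mkcond [leRHS]big_mkcond; apply: ler_sum => w _.
by case: ifPn => [/rX[->]//|_]; case: ifP.
Qed.

(** Convergence half of the Borel-Cantelli argument: for every N the sets of admissible words of
    length at least N cover E, and their s-sum is a geometric tail. *)
Lemma hausdorff_null_limsup (I : seq A -> set R) (d : seq A -> R) (hi C q s : R)
    (P : pred (seq A)) (E : set R) :
  0 <= s -> 0 < hi < 1 -> 0 <= C -> 0 < q < 1 ->
  (forall w, d w <= hi ^+ size w) ->
  (forall w x y, I w x -> I w y -> `|x - y| <= d w) ->
  (forall n, \sum_(w <- words A n | P w) d w `^ s <= C * q ^+ n) ->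
  (forall x, E x -> forall N, exists w, [/\ (N <= size w)%N, P w & I w x]) ->
  hausdorff_null s E.
Proof.
move=> s0 hi01 C0 q01 dhi dI dsum EI.
apply: (@hausdorff_null_countType _ (seq A)) => r e r0 e0.
have lt01W (x : R) : 0 < x < 1 -> 0 <= x < 1 by move=> /andP[/ltW-> ->].
have [N1 HN1] := geometric_small (lt01W _ hi01) ler01 r0.
have C1 : 0 <= C / (1 - q) by rewrite divr_ge0// subr_ge0; case/andP: q01 => _ /ltW.
have [N2 HN2] := geometric_small (lt01W _ q01) C1 e0.
pose N := maxn N1 N2.
exists (fun w => if P w && (N <= size w)%N then I w else set0); split.
- move=> w; case: ifP => [/andP[_ Nw]|_]; last by rewrite diam_set0 leNye.
  apply: diam_le => x y Ix Iy; rewrite (le_trans (dI _ _ _ Ix Iy))// (le_trans (dhi w))//.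
  by rewrite -[leLHS]mul1r HN1// (leq_trans (leq_maxl _ _) Nw).
- by move=> x /EI/(_ N)[w [Nw Pw Ix]]; exists w => //; rewrite Pw Nw.
apply: le_trans (_ : \esum_(w in [set w | P w /\ (N <= size w)%N]) (d w `^ s)%:E <= _)%E.
  rewrite [leRHS]esum_mkcond; apply: le_esum => w _.
  case: ifPn => [/andP[Pw Nw]|_]; last by rewrite diam_pow_set0; case: ifP; rewrite // lee_fin powR_ge0.
  rewrite mem_set//; apply: diam_pow_le => //.
  by apply: diam_le => x y; exact: dI.
apply: le_trans (esum_words_geometric _ _ C0 q01 dsum) _ => [w|]; first exact: powR_ge0.
by rewrite lee_fin mulrCA mulrC HN2// leq_maxr.
Qed.

End limsup.

(** * Lower bound for the dimension of the limit set of a tree *)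

Section tree.
Variables (R : realType) (A : finType) (I : seq A -> set R) (ell : seq A -> R).
Variables (s rho : R) (N : nat) (T : pred (seq A)).
Hypotheses (ell_gt0 : forall w, 0 < ell w)
  (I_diam : forall w x y, I w x -> I w y -> `|x - y| <= ell w)
  (I_ends : forall w, exists x y, [/\ I w x, I w y & `|x - y| = ell w])
  (I_nested : forall u v, I (u ++ v) `<=` I u)
  (I_sep : forall u v, size u = size v -> u != v ->
     (forall x y, I u x -> I v y -> x <= y) \/ (forall x y, I u x -> I v y -> y <= x))
  (s_gt0 : 0 < s) (rho_gt0 : 0 < rho) (rho_le1 : rho <= 1)
  (ell_child : forall u b, size b = N -> rho * ell u <= ell (u ++ b))
  (T_nil : T [::])
  (T_sum : forall u, T u ->
     2 * ell u `^ s <= \sum_(b <- words A N | T (u ++ b)) ell (u ++ b) `^ s).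

Fixpoint descendant n (u v : seq A) : Prop :=
  if n is n'.+1 then
    exists b, [/\ size b = N, T (u ++ b) & descendant n' (u ++ b) v]
  else v = u.

Lemma descendant_sub n u v : descendant n u v -> I v `<=` I u.
Proof.
elim: n u => [|n IH] u /=; first by move=> ->.
by move=> [b [_ _ /IH]] /subset_trans; apply; exact: I_nested.
Qed.

Lemma descendant_size n u v : descendant n u v -> size v = (size u + n * N)%N.
Proof.
elim: n u => [|n IH] u /=; first by move=> ->; rewrite addn0.
by move=> [b [bN _ /IH]] ->; rewrite size_cat bN mulSn addnA.
Qed.

Lemma descendantD n k u v : descendant (n + k) u v ->
  exists2 w, descendant n u w & descendant k w v.
Proof.
elim: n u => [|n IH] u /=; first by exists u.
by move=> [b [bN Tb /IH[w uw wv]]]; exists w => //; exists b.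
Qed.

Definition convex_hits (j : R * R) u := exists2 x, I u x & j.1 <= x <= j.2.

(** An interval that meets the pieces on both sides of [I b] contains both ends of [I b], which are
    [ell b] apart. *)
Lemma middle_child (j : R * R) a b c :
  convex_hits j a -> convex_hits j c ->
  (forall x y, I a x -> I b y -> x <= y) -> (forall x y, I b x -> I c y -> x <= y) ->
  ell b <= j.2 - j.1.
Proof.
move=> [x Ix /andP[jx _]] [y Iy /andP[_ yj]] ab bc.
have [p [q [Ip Iq <-]]] := I_ends b.
have := ab _ _ Ix Ip; have := ab _ _ Ix Iq; have := bc _ _ Ip Iy; have := bc _ _ Iq Iy.
by move=> *; rewrite ler_norml; apply/andP; split; lra.
Qed.

(** One of three pairwise separated pieces lies between the other two. All eight patterns of
    relations are covered, the cyclic ones included, since [middle_child] uses only two of the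
    relations. *)
Lemma three_children (j : R * R) a b c :
  size a = size b -> size b = size c -> a != b -> b != c -> a != c ->
  convex_hits j a -> convex_hits j b -> convex_hits j c ->
  exists2 d, d \in [:: a; b; c] & ell d <= j.2 - j.1.
Proof.
move=> sab sbc nab nbc nac ja jb jc.
have rev u v : (forall x y, I u x -> I v y -> y <= x) -> (forall x y, I v x -> I u y -> x <= y).
  by move=> h x y *; apply: h.
have [ab|/rev ba] := I_sep sab nab; have [bc|/rev cb] := I_sep sbc nbc;
  have [ac|/rev ca] := I_sep (etrans sab sbc) nac.
- by exists b; rewrite ?inE ?eqxx ?orbT//; apply: (middle_child ja jc).
- by exists b; rewrite ?inE ?eqxx ?orbT//; apply: (middle_child ja jc).
- by exists c; rewrite ?inE ?eqxx ?orbT//; apply: (middle_child ja jb).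
- by exists a; rewrite ?inE ?eqxx ?orbT//; apply: (middle_child jc jb).
- by exists a; rewrite ?inE ?eqxx ?orbT//; apply: (middle_child jb jc).
- by exists c; rewrite ?inE ?eqxx ?orbT//; apply: (middle_child jb ja).
- by exists b; rewrite ?inE ?eqxx ?orbT//; apply: (middle_child jc ja).
- by exists b; rewrite ?inE ?eqxx ?orbT//; apply: (middle_child jc ja).
Qed.

(* An interval shorter than every child of [u] meets at most two of them,
   while passing to the children at least doubles the sum of the [ell ^ s]. *)
Lemma finite_cover_lower_bound n u (js : seq (R * R)) : T u ->
  (forall v, descendant n u v -> exists2 j, j \in js & I v `<=` `[j.1, j.2]) ->
  (rho * ell u) `^ s <= \sum_(j <- js) `|j.2 - j.1| `^ s.
Proof.
have big_j (js' : seq (R * R)) j x : 0 <= x -> j \in js' -> x <= j.2 - j.1 ->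
    x `^ s <= \sum_(j <- js') `|j.2 - j.1| `^ s.
  move=> x0 jjs xj; rewrite (perm_big _ (perm_to_rem jjs))/= big_cons.
  apply: le_trans (_ : `|j.2 - j.1| `^ s <= _); last by rewrite lerDl sumr_ge0// => *; exact: powR_ge0.
  by rewrite ge0_ler_powR ?nnegrE// ?(ltW s_gt0)// (le_trans xj)// ler_norm.
have hits v u' (j : R * R) : I v `<=` `[j.1, j.2] -> I v `<=` I u' -> convex_hits j u'.
  move=> vj vu; have [x [_ [Ix _ _]]] := I_ends v.
  by exists x; [exact: vu|have := vj _ Ix; rewrite /= in_itv].
elim: n u js => [|n IH] u js Tu cov.
  have [//|j jjs uj] := cov u; apply: (big_j _ j) => //; first by rewrite ltW// mulr_gt0.
  apply: le_trans (_ : ell u <= _); first by rewrite ler_piMl// ltW.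
  have [x [y [Ix Iy <-]]] := I_ends u.
  have := uj _ Ix; have := uj _ Iy; rewrite /= !in_itv/= => /andP[? ?] /andP[? ?].
  by rewrite ler_norml; apply/andP; split; lra.
(* One interval of length at least [rho * ell u] suffices by itself; otherwise every interval is
   shorter than each child of u. *)
have [[j jjs jbig]|nbig] := pselect (exists2 j, j \in js & rho * ell u <= j.2 - j.1).
  by apply: (big_j _ j) => //; rewrite ltW// mulr_gt0.
(* Only intervals that contain the piece of a descendant of the child count: they still cover the
   generation below that child, so the induction hypothesis applies to them. *)
pose hit (j : R * R) b := `[< exists2 v, descendant n (u ++ b) v & I v `<=` `[j.1, j.2] >].
have hitE j b : hit j b -> convex_hits j (u ++ b).
  by move=> /asboolP[v uv vj]; apply: (hits v) => //; exact: descendant_sub uv.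
have child b : size b = N -> T (u ++ b) ->
    (rho * ell (u ++ b)) `^ s <= \sum_(j <- js | hit j b) `|j.2 - j.1| `^ s.
  move=> bN Tb; rewrite -big_filter; apply: IH => // v uv.
  have [|j jjs vj] := cov v; first by exists b.
  by exists j => //; rewrite mem_filter jjs andbT; apply/asboolP; exists v.
have two j : j \in js -> (count (fun b => T (u ++ b) && hit j b) (words A N) <= 2)%N.
  move=> jjs; rewrite leqNgt -size_filter; apply/negP.
  set l := seq.filter _ _ => l3.
  have lu : uniq l by rewrite filter_uniq// words_uniq.
  have lP b : b \in l -> size b = N /\ convex_hits j (u ++ b).
    by rewrite mem_filter mem_words => /andP[/andP[_ /hitE ?] /eqP].
  case: l l3 lu lP => [//|a [//|b [//|c l]]] _ /=.
  rewrite !inE !negb_or => /and4P[/and3P[ab ac _] /andP[bc _] _ _] lP.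
  have [aN ja] := lP a (mem_head _ _).
  have [bN jb] : size b = N /\ convex_hits j (u ++ b) by apply: lP; rewrite !inE eqxx orbT.
  have [cN jc] : size c = N /\ convex_hits j (u ++ c) by apply: lP; rewrite !inE eqxx !orbT.
  have [||||| d dabc dj] := three_children _ _ _ _ _ ja jb jc.
  - by rewrite !size_cat aN bN.
  - by rewrite !size_cat bN cN.
  - by rewrite eqseq_cat// eqxx.
  - by rewrite eqseq_cat// eqxx.
  - by rewrite eqseq_cat// eqxx.
  apply: nbig; exists j => //; apply: le_trans dj.
  by move: dabc; rewrite !inE => /or3P[] /eqP->; exact: ell_child.
rewrite -(ler_pM2l (ltr0n R 2)) /=.
apply: le_trans (_ : \sum_(b <- words A N | T (u ++ b)) (rho * ell (u ++ b)) `^ s <= _).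
  rewrite powRM ?(ltW rho_gt0) ?(ltW (ell_gt0 _))// mulrCA.
  under eq_bigr do rewrite powRM ?(ltW rho_gt0) ?(ltW (ell_gt0 _))//.
  by rewrite -mulr_sumr ler_wpM2l ?powR_ge0// T_sum.
apply: le_trans (_ : \sum_(b <- words A N | T (u ++ b)) \sum_(j <- js | hit j b) `|j.2 - j.1| `^ s <= _).
  rewrite big_seq_cond [leRHS]big_seq_cond; apply: ler_sum => b /andP[].
  by rewrite mem_words => /eqP; exact: child.
rewrite (exchange_big_dep xpredT)//= mulr_sumr big_seq [leRHS]big_seq.
apply: ler_sum => j /two jtwo; rewrite big_const_seq iter_addr_0 -[leLHS]mulr_natl.
by rewrite ler_wpM2r ?powR_ge0// ler_nat.
Qed.

Variables (i0 : A) (pi : (nat -> A) -> R).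
Hypotheses (N_gt0 : (0 < N)%N)
  (pi_in : forall x n, I (mkseq x n) (pi x))
  (ell_cvg0 : forall e, 0 < e -> exists n0, forall w, (n0 <= size w)%N -> ell w < e).

Definition tree_limit : set (nat -> A) := [set x | forall n, T (mkseq x (n * N))].

Section koenig.
Variable J : nat -> R * R.
Hypothesis J_cover : forall x, tree_limit x ->
  exists i, exists2 e, 0 < e & `](pi x - e), (pi x + e)[ `<=` `[(J i).1, (J i).2].

(** Compactness by König's lemma. If no generation were covered, following bad nodes would give an
    infinite branch; a neighbourhood of its point lies in one [J i], which then contains the piece
    of a long prefix. *)
Lemma koenig_level : exists n, forall v, descendant n [::] v ->
  exists i, I v `<=` `[(J i).1, (J i).2].
Proof.
apply: contrapT => /forallNP nolevel.
pose bad u := forall n, ~ forall v, descendant n u v -> exists i, I v `<=` `[(J i).1, (J i).2].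
(* If every child had a covered generation, the largest of these finitely many depths plus one would
   serve for u. The condition [bad u] stands under the existential so that choice gives a total
   function. *)
have step u : exists b, bad u -> size b = N /\ T (u ++ b) /\ bad (u ++ b).
  apply: contrapT => /forallNP nb.
  have bu : bad u by apply: contrapT => nbu; apply: (nb [::]).
  have lev b : exists n, size b = N -> T (u ++ b) ->
      forall v, descendant n (u ++ b) v -> exists i, I v `<=` `[(J i).1, (J i).2].
    apply: contrapT => /forallNP nn; apply: (nb b) => _.
    have [bN Tb] : size b = N /\ T (u ++ b).
      by apply: contrapT => h; apply: (nn 0%N) => bN Tb; case: h.
    by split=> //; split=> // n h; apply: (nn n).
  have [h hP] := choice lev.
  pose M := (\max_(b <- words A N) h b)%N.
  apply: (bu M.+1) => v [b [bN Tb bv]].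
  have hM : (h b <= M)%N by rewrite (@leq_bigmax_seq _ _ xpredT)// mem_words bN.
  move: bv; rewrite -(subnKC hM) => /descendantD[w bw wv].
  have [i wJ] := hP b bN Tb w bw; exists i.
  by apply: subset_trans wJ; exact: descendant_sub wv.
have [next nextP] := choice step.
pose u k := iter k (fun u => u ++ next u) [::].
have uS k : u k.+1 = u k ++ next (u k) by [].
have ubad k : bad (u k).
  elim: k => [|k IH]; first by move=> n; exact: nolevel.
  by rewrite uS; have [_ []] := nextP _ IH.
have uN k : size (u k) = (k * N)%N.
  elim: k => // k IH; rewrite uS size_cat IH mulSn addnC.
  by have [-> _] := nextP _ (ubad k).
have uT k : T (u k).
  by case: k => [|k]; [exact: T_nil|have [_ []] := nextP _ (ubad k)].
have pref k l n : (n < size (u k))%N -> nth i0 (u (k + l)%N) n = nth i0 (u k) n.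
  elim: l => [|l IH] nk; first by rewrite addn0.
  rewrite addnS uS nth_cat -{}IH// ifT// uN (leq_trans nk)// uN leq_mul2r leq_addr orbT//.
(* The node [u n.+1] has length (n + 1) N > n because N is positive, so the default letter is never
   read. *)
pose x n := nth i0 (u n.+1) n.
have xu k : mkseq x (k * N) = u k.
  apply: (@eq_from_nth _ i0); rewrite size_mkseq ?uN// => n nk.
  rewrite nth_mkseq// /x; have n1 : (n < size (u n.+1))%N.
    by rewrite uN leq_pmulr.
  have [kn|/ltnW nk'] := leqP k n.+1.
    by rewrite -(subnKC kn) pref// uN.
  by rewrite -(subnKC nk') pref.
have [|i [e e0 xJ]] := J_cover (x := x); first by move=> n; rewrite xu.
have [n0 Hn0] := ell_cvg0 e0.
apply: (ubad n0 0%N) => v /= ->; exists i.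
have Ix : I (u n0) (pi x) by rewrite -xu; exact: pi_in.
have small : ell (u n0) < e by apply: Hn0; rewrite uN leq_pmulr.
apply: subset_trans xJ => y Iy; rewrite /= in_itv/=.
have := le_lt_trans (I_diam Iy Ix) small.
by rewrite ltr_distl => /andP[-> ->].
Qed.

End koenig.

(** A cover with small s-sum is enlarged to intervals containing a neighbourhood of each limit
    point. By [koenig_level] finitely many of them cover a whole generation, against
    [finite_cover_lower_bound]. *)
Lemma tree_limit_not_null : ~ hausdorff_null s (pi @` tree_limit).
Proof.
set K := (rho * ell [::]) `^ s.
have K0 : 0 < K by rewrite powR_gt0// mulr_gt0.
have C0 : 0 < 2 `^ s :> R by rewrite powR_gt0.
(* The enlarged intervals have length [2 * t i] and s-sum at most 2 ^ s (e + e) = K / 2 < K. *)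
pose e := K / (2 `^ s) / 4.
have e0 : 0 < e by rewrite !divr_gt0.
move=> /(_ 1 e ltr01 e0)[U [dU EU Ue]].
pose d i := fine (diam (U i)).
have d0 i : 0 <= d i.
  have [Ui|/set0P U0] := eqVneq (U i) set0; first by rewrite /d Ui diam_set0.
  by rewrite fine_ge0// diam_ge0.
have dE i x y : U i x -> U i y -> `|x - y| <= d i.
  move=> Ux Uy; have := diam_ge Ux Uy; have := dU i; rewrite /d.
  by case: (diam (U i)) => //= r; rewrite !lee_fin.
have dpE i : diam_pow s (U i) = (d i `^ s)%:E.
  rewrite /diam_pow; case: ifPn => [/eqP Ui|/set0P U0].
    by rewrite /d Ui diam_set0 /= powR0// gt_eqF.
  by have := dU i; have := diam_ge0 U0; rewrite /d; case: (diam (U i)).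
(* A radius slightly above the diameter, chosen so that its s-th power exceeds that of [d i] by a
   summable error of total at most e. *)
pose t i := (d i `^ s + e / (2 ^ i.+1)%:R) `^ s^-1.
have ei i : 0 < e / (2 ^ i.+1)%:R by rewrite divr_gt0// ltr0n expn_gt0.
have tE i : t i `^ s = d i `^ s + e / (2 ^ i.+1)%:R.
  by rewrite /t -powRrM mulVf ?gt_eqF// powRr1// addr_ge0 ?powR_ge0// ltW.
have t0 i : 0 <= t i by rewrite powR_ge0.
have dt i : d i < t i.
  rewrite ltNge; apply/negP => td.
  have : t i `^ s <= d i `^ s by rewrite ge0_ler_powR ?nnegrE// ltW.
  by rewrite tE gerDl leNgt ei.
(* The centre is a point of [U i]; an empty [U i] gives an interval about 0, whose length is counted
   in the sum as well. *)
pose J i := (xget 0 (U i) - t i, xget 0 (U i) + t i).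
have [|n Hn] := @koenig_level J.
  move=> x Tx; have [i _ Uix] := EU _ (imageP pi Tx).
  exists i; exists (t i - d i); first by rewrite subr_gt0.
  have Ug : U i (xget 0 (U i)) by case: xgetP => [y -> //|/(_ (pi x))].
  have := dE i _ _ Uix Ug; rewrite ler_distl => /andP[h1 h2] y.
  by rewrite /J /= !in_itv/= => /andP[? ?]; apply/andP; split; lra.
have /choice[f fP] v : exists i, descendant n [::] v -> I v `<=` `[(J i).1, (J i).2].
  have [/Hn[i vi]|] := pselect (descendant n [::] v); first by exists i.
  by exists 0%N.
pose k := (\max_(v <- words A (n * N)) f v).+1.
have := @finite_cover_lower_bound n [::] [seq J i | i <- iota 0 k] T_nil.
rewrite -/K leNgt => /(_ _)/negP; apply.
  move=> v dv; exists (J (f v)); last exact: fP.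
  apply: map_f; rewrite mem_iota/= add0n ltnS.
  by rewrite (@leq_bigmax_seq _ _ xpredT)// mem_words (descendant_size dv).
rewrite big_map.
have -> : \sum_(i <- iota 0 k) `|(J i).2 - (J i).1| `^ s =
    2 `^ s * (\sum_(i <- iota 0 k) d i `^ s + \sum_(i <- iota 0 k) e / (2 ^ i.+1)%:R).
  rewrite -big_split mulr_sumr; apply: eq_bigr => i _ /=.
  rewrite -tE -powRM// /J /= (_ : _ - _ = 2 * t i); last by ring.
  by rewrite ger0_norm// mulr_ge0.
have s1 : \sum_(i <- iota 0 k) d i `^ s <= e.
  rewrite -lee_fin -sumEFin; apply: le_trans Ue.
  under eq_bigr do rewrite -dpE.
  have := @nneseries_lim_ge R (fun i => diam_pow s (U i)) xpredT 0 k.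
  by rewrite /index_iota subn0; apply => i _ _; exact: diam_pow_ge0.
have s2 : \sum_(i <- iota 0 k) e / (2 ^ i.+1)%:R <= e.
  rewrite -lee_fin -sumEFin; apply: le_trans (epsilon_trick0 xpredT (ltW e0)).
  have := @nneseries_lim_ge R (fun i => (e / (2 ^ i.+1)%:R)%:E) xpredT 0 k.
  by rewrite /index_iota subn0; apply => i _ _; rewrite lee_fin ltW.
rewrite -ltr_pdivlMl//.
apply: le_lt_trans (lerD s1 s2) _; rewrite mulrC.
have : 0 < K / 2 `^ s by rewrite divr_gt0.
by rewrite /e; lra.
Qed.

End tree.

(** * Geometry of the branches *)

Section derivable_within.
Context {R : realType}.
Implicit Types (J : set R) (f : R -> R).

Lemma diff_quot_near J f x : derivable_within J f x -> forall e, 0 < e ->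
  exists2 r, 0 < r & forall y, J y -> y != x -> `|x - y| < r ->
    `|derive_within J f x - diff_quot f x y| < e.
Proof.
move=> dJ e e0; have /cvgrPdist_lt/(_ e e0) : diff_quot f x @ within J x^' --> derive_within J f x.
  exact: dJ.
move=> /nbhs_ballP[r /= r0 rP]; exists r => // y Jy yx xy.
exact: (rP y).
Qed.

Lemma within_continuous_dist J f :
  (forall x, J x -> forall e, 0 < e -> exists2 r, 0 < r &
    forall y, J y -> `|x - y| < r -> `|f x - f y| < e) ->
  {within J, continuous f}.
Proof.
move=> H; apply/subspace_continuousP => x Jx; apply/cvgrPdist_lt => e e0.
have [r r0 rP] := H x Jx e e0.
by apply/nbhs_ballP; exists r => //= y xy Jy; exact: rP.
Qed.

Lemma within_derivable_continuous J f :
  (forall x, J x -> derivable_within J f x) -> {within J, continuous f}.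
Proof.
move=> dJ; apply: within_continuous_dist => x Jx e e0.
have [r r0 rP] := diff_quot_near (dJ x Jx) ltr01.
set l := derive_within J f x in rP.
have l0 : 0 < `|l| + 1 by rewrite ltr_wpDl.
exists (Order.min r (e / (`|l| + 1))); first by rewrite lt_min r0 divr_gt0.
move=> y Jy; rewrite lt_min => /andP[xyr xye].
have [->|yx] := eqVneq y x; first by rewrite subrr normr0.
have := rP y Jy yx xyr => H1.
have yx0 : y - x != 0 by rewrite subr_eq0.
have -> : f x - f y = diff_quot f x y * (x - y).
  by rewrite /diff_quot; field.
rewrite normrM; move: xye; rewrite ltr_pdivlMr// => /(le_lt_trans _); apply.
rewrite mulrC ler_wpM2l//.
have -> : diff_quot f x y = l - (l - diff_quot f x y) by ring.
by rewrite (le_trans (ler_normB _ _))// lerD2l ltW.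
Qed.

(** Inside the interval all points near z belong to J, so the relative derivative is the ordinary
    one and the usual mean value theorem applies. *)
Lemma is_derive_within J f x y z : is_interval J -> J x -> J y ->
  (forall t, J t -> derivable_within J f t) ->
  z \in `]x, y[ -> is_derive z 1 f (derive_within J f z).
Proof.
move=> iJ Jx Jy dJ zxy.
have Jz t : x < t < y -> J t by move=> /andP[xt ty]; apply: (iJ x y) => //; rewrite !ltW.
move: zxy; rewrite in_itv/= => zxy; have /andP[xz zy] := zxy.
suff cv : h^-1 *: ((f \o shift z) (h *: (1:R)) - f z) @[h --> 0^'] --> derive_within J f z.
  split; first by apply/cvg_ex; exists (derive_within J f z).
  by apply: cvg_lim => //; exact: cv.
apply/cvgrPdist_lt => e e0.
have [r r0 rP] := diff_quot_near (dJ z (Jz z zxy)) e0.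
pose d := Order.min r (Order.min (z - x) (y - z)).
have d0 : 0 < d by rewrite !lt_min r0 !subr_gt0 xz zy.
apply/nbhs_ballP; exists d => //= h; rewrite /ball/= sub0r normrN !lt_min.
move=> /and3P[hr hx hy] h0.
have := rP (h + z); rewrite /diff_quot addrK.
rewrite /= scaler1 [_ *: _]mulrC; apply.
- apply: Jz; move: hx hy; rewrite !ltr_norml => /andP[? ?] /andP[? ?].
  by apply/andP; split; lra.
- by rewrite -subr_eq0 addrK.
- by rewrite opprD addrCA subrr addr0 normrN.
Qed.

Lemma MVT_within J f x y : is_interval J -> J x -> J y ->
  (forall t, J t -> derivable_within J f t) -> x <= y ->
  exists2 z, x <= z <= y & f y - f x = derive_within J f z * (y - x).
Proof.
move=> iJ Jx Jy dJ xy; have [//|||c cxy ->] := @MVT_segment R f (derive_within J f) x y.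
- by move=> z; exact: is_derive_within.
- apply: (@continuous_subspaceW _ _ _ J); last exact: within_derivable_continuous.
  by move=> t /=; rewrite in_itv/=; exact: iJ.
- by exists c => //; rewrite in_itv in cxy.
Qed.

Lemma MVT_within_norm J f x y : is_interval J -> J x -> J y ->
  (forall t, J t -> derivable_within J f t) ->
  exists z, [/\ J z, `|x - z| <= `|x - y| &
    `|f x - f y| = `|derive_within J f z| * `|x - y|].
Proof.
move=> iJ Jx Jy dJ; have [xy|/ltW yx] := leP x y.
  have [z xzy E] := MVT_within iJ Jx Jy dJ xy; exists z.
  have /andP[xz zy] := xzy; split; first exact: (iJ x y).
    by rewrite distrC [leRHS]distrC !ger0_norm ?subr_ge0// lerB.
  by rewrite distrC E normrM [`|y - x|]distrC.
have [z xzy E] := MVT_within iJ Jy Jx dJ yx; exists z.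
have /andP[xz zy] := xzy; split; first exact: (iJ y x).
  by rewrite !ger0_norm ?subr_ge0// lerB.
by rewrite E normrM.
Qed.

Lemma holder_within_continuous J (g : R -> R) (C eps : R) : 0 < eps ->
  (forall x y, J x -> J y -> `|g x - g y| <= C * `|x - y| `^ eps) ->
  {within J, continuous g}.
Proof.
move=> eps0 gC; apply: within_continuous_dist => x Jx e e0.
have C1 : 0 < `|C| + 1 by rewrite ltr_wpDl.
exists ((e / (`|C| + 1)) `^ eps^-1); first by rewrite powR_gt0// divr_gt0.
move=> y Jy xy; apply: le_lt_trans (gC x y Jx Jy) _.
apply: le_lt_trans (_ : `|C| * `|x - y| `^ eps < _).
  by rewrite ler_wpM2r ?powR_ge0// ler_norm.
have : `|x - y| `^ eps < e / (`|C| + 1).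
  rewrite (lt_le_trans (gt0_ltr_powR eps0 _ _ xy)) ?nnegrE ?powR_ge0//.
  by rewrite -powRrM mulVf ?gt_eqF// powRr1// divr_ge0// ltW.
rewrite ltr_pdivlMr// => /(le_lt_trans _); apply.
by rewrite mulrC ler_wpM2l ?powR_ge0// lerDl.
Qed.

End derivable_within.

(** The inequalities are weak so that the relation passes to closures: neighbouring closed pieces
    may share an end point. *)
Definition side_by_side {R : realType} (E E' : set R) :=
  (forall x y, E x -> E' y -> x <= y) \/ (forall x y, E x -> E' y -> y <= x).

(** The end points are unordered because branches may reverse orientation. *)
Definition between {R : realType} (a b y : R) := (a <= y <= b) || (b <= y <= a).

Lemma betweenE {R : realType} (a b y : R) :
  between a b y = (Num.min a b <= y <= Num.max a b).
Proof.
rewrite /between; case: (leP a b) => ab.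
  apply/orP/idP => [[//|/andP[h1 h2]]|]; last by left.
  by apply/andP; split; lra.
apply/orP/idP => [[/andP[h1 h2]|//]|]; last by right.
by apply/andP; split; lra.
Qed.

Section side_by_side.
Context {R : realType}.
Implicit Types E : set R.

Lemma side_by_side_sub E1 E1' E2 E2' : E1 `<=` E1' -> E2 `<=` E2' ->
  side_by_side E1' E2' -> side_by_side E1 E2.
Proof. by move=> s1 s2 [h|h]; [left|right] => x y /s1 ? /s2 ?; apply: h. Qed.

Lemma side_by_side_sym E E' : side_by_side E E' -> side_by_side E' E.
Proof. by move=> [h|h]; [right|left] => x y ? ?; apply: h. Qed.

Lemma side_by_side_interval E E' : is_interval E -> is_interval E' ->
  E !=set0 -> E' !=set0 -> E `&` E' = set0 -> side_by_side E E'.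
Proof.
wlog [a [b [Ea E'b ab]]] : E E' / exists a b, [/\ E a, E' b & a < b].
  move=> H iE iE' [a Ea] [b E'b] dis; have [ab|ba|ab] := ltgtP a b.
  - by apply: H; rewrite //; [exists a, b|exists a|exists b].
  - apply: side_by_side_sym; apply: (H E' E) => //; last by rewrite setIC.
    + by exists b, a.
    + by exists b.
    + by exists a.
  - have : (E `&` E') a by split => //; rewrite ab.
    by rewrite dis.
move=> iE iE' _ _ dis; left => x y Ex E'y; rewrite leNgt; apply/negP => yx.
have no z : E z -> E' z -> False.
  by move=> Ez E'z; rewrite -[False]/(set0 z) -dis.
have [ya|ay] := leP y a; first by apply: (no a) => //; apply: (iE' y b) => //; rewrite ya ltW.
by apply: (no y) => //; apply: (iE a x) => //; rewrite !ltW.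
Qed.

Lemma closure_le_ge E E' : (forall x y, E x -> E' y -> x <= y) ->
  forall x y, closure E x -> closure E' y -> x <= y.
Proof.
move=> h; have h1 x y : closure E x -> E' y -> x <= y.
  move=> Ex E'y; have : closure [set z | z <= y] x.
    by apply: closure_subset Ex => z Ez; exact: h.
  by rewrite -(iffLR (closure_id _))//; exact: closed_le.
move=> x y Ex E'y; have : closure [set z | x <= z] y.
  by apply: closure_subset E'y => z E'z; exact: h1.
by rewrite -(iffLR (closure_id _))//; exact: closed_ge.
Qed.

Lemma side_by_side_closure E E' : side_by_side E E' -> side_by_side (closure E) (closure E').
Proof.
move=> [h|h]; [left|right] => x y Ex Ey; first exact: (closure_le_ge h).
by apply: (@closure_le_ge E' E _ _ _ Ey Ex) => u v ? ?; exact: h.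
Qed.

End side_by_side.

(** * Nested pieces and the coding map *)

Section geometry.
Variables (R : realType) (p : nat) (F : expanding_map R 'I_p.+2).
Implicit Types (i : 'I_p.+2) (w : word p) (x : sigma p).

Definition cedom i : set R := closure (edom F i).

Definition branch_slope i t : R := `|derive_within (cedom i) (branch F i) t|.

Lemma edom_neq0 i : edom F i !=set0.
Proof. by have [t /interior_subset] := edom_interior F i; exists t. Qed.

Lemma cedom_interval i : is_interval (cedom i).
Proof.
apply/connected_intervalP/connected_closure/connected_intervalP.
exact: edom_interval.
Qed.

Lemma cedom_sub i : cedom i `<=` `[0, 1].
Proof.
move=> t /(closure_subset (@edom_sub _ _ F i)).
by rewrite -(iffLR (closure_id _))//; exact: interval_closed.
Qed.

Lemma cedom_side_by_side i j : i != j -> side_by_side (cedom i) (cedom j).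
Proof.
move=> ij; apply/side_by_side_closure/side_by_side_interval; try exact: edom_interval; try exact: edom_neq0.
by apply: contraNeq ij => /set0P[t [Ei Ej]]; apply/eqP/(@edom_disjoint _ _ F) => //; exists t.
Qed.

Lemma branch_in i t : cedom i t -> `[0, 1]%classic (branch F i t).
Proof. by move=> it; have [eps _ H] := branch_diffeo F; have [/(_ _ it)[]] := H i. Qed.

Lemma branchK i t : cedom i t -> ibranch F i (branch F i t) = t.
Proof. by move=> it; have [eps _ H] := branch_diffeo F; have [/(_ _ it)[]] := H i. Qed.

Lemma ibranch_in i t : `[0, 1]%classic t -> cedom i (ibranch F i t).
Proof. by move=> it; have [eps _ H] := branch_diffeo F; have [_ /(_ _ it)[]] := H i. Qed.

Lemma ibranchK i t : `[0, 1]%classic t -> branch F i (ibranch F i t) = t.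
Proof. by move=> it; have [eps _ H] := branch_diffeo F; have [_ /(_ _ it)[]] := H i. Qed.

Lemma branch_derivable i t : cedom i t -> derivable_within (cedom i) (branch F i) t.
Proof. by move=> it; have [eps _ H] := branch_diffeo F; have [_ _ [h _] _] := H i; exact: h. Qed.

Lemma unit_itv0 : `[0, 1]%classic (0 : R). Proof. by rewrite /= in_itv/= lexx ler01. Qed.
Lemma unit_itv1 : `[0, 1]%classic (1 : R). Proof. by rewrite /= in_itv/= lexx ler01. Qed.
Hint Resolve unit_itv0 unit_itv1 : core.

Lemma ibranch_mono i :
  (forall s t, `[0, 1]%classic s -> `[0, 1]%classic t ->
     (ibranch F i s <= ibranch F i t) = (s <= t)) \/
  (forall s t, `[0, 1]%classic s -> `[0, 1]%classic t ->
     (ibranch F i s <= ibranch F i t) = (t <= s)).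
Proof.
have hC : {within [set` `[0, 1]], continuous (ibranch F i)}.
  apply: within_derivable_continuous.
  by have [eps _ H] := branch_diffeo F; have [_ _ _ [h _]] := H i.
have hI : {in `[0, 1] &, injective (ibranch F i)}.
  by move=> s t s01 t01 st; rewrite -(ibranchK i s01) st ibranchK.
have := itv_continuous_inj_mono hC hI.
by move=> [/le_mono_in h|/le_nmono_in h]; [left|right] => s t s01 t01; rewrite h.
Qed.

Lemma ibranch_between i a b t : `[0, 1]%classic a -> `[0, 1]%classic b ->
  `[0, 1]%classic t ->
  between (ibranch F i a) (ibranch F i b) (ibranch F i t) = between a b t.
Proof.
move=> a01 b01 t01; rewrite /between.
by have [h|h] := ibranch_mono i; rewrite !h// andbC [in X in _ || X]andbC orbC.
Qed.

Lemma slope_holder : exists2 eps : R, 0 < eps & exists2 C : R, 0 < C &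
  forall i s t, cedom i s -> cedom i t ->
    `|branch_slope i s - branch_slope i t| <= C * `|s - t| `^ eps.
Proof.
have [eps eps0 H] := branch_diffeo F; exists eps => //.
have /choice[C HC] i : exists C : R, forall s t, cedom i s -> cedom i t ->
    `|derive_within (cedom i) (branch F i) s - derive_within (cedom i) (branch F i) t|
      <= C * `|s - t| `^ eps.
  by have [_ _ [_ h] _] := H i.
have [M M0 CM] := finite_bound C; exists M => // i s t si ti.
apply: le_trans (ler_dist_dist _ _) _; apply: le_trans (HC i s t si ti) _.
by rewrite ler_wpM2r ?powR_ge0// (le_trans (ler_norm _)).
Qed.

Lemma cedom_compact i : compact (cedom i).
Proof.
apply: (subclosed_compact _ (@segment_compact _ 0 1)); last exact: cedom_sub.
exact: closed_closure.
Qed.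

(** The slope is continuous on each compact closed domain, so its minimum there exceeds 1; finitely
    many letters then give a uniform bound. *)
Lemma slope_ge : exists2 lam : R, 1 < lam &
  forall i t, cedom i t -> lam <= branch_slope i t.
Proof.
have [eps eps0 [C C0 HC]] := slope_holder.
have /choice[l Hl] i : exists l : R, 1 < l /\ forall t, cedom i t -> l <= branch_slope i t.
  have [||t ti tmin] := @compact_EVT_min _ R (branch_slope i) _ _ (@cedom_compact i).
  - by have [t Et] := edom_neq0 i; exists t; exact: subset_closure.
  - exact: (holder_within_continuous eps0 (HC i)).
  rewrite inE in ti; exists (branch_slope i t); split; first exact: branch_expanding.
  by move=> u ui; apply: tmin; rewrite inE.
(* An upper bound for the inverses of [l i - 1] gives a positive lower bound for all [l i - 1]. *)
have [M M0 lM] := finite_bound (fun i => (l i - 1)^-1).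
exists (1 + M^-1); first by rewrite ltrDl invr_gt0.
move=> i t it; have [l1 lt] := Hl i; apply: le_trans (lt t it).
have l0 : 0 < l i - 1 by rewrite subr_gt0.
rewrite -lerBrDl -[leRHS]invrK lef_pV2 ?posrE ?invr_gt0//.
exact: le_trans (ler_norm _) (lM i).
Qed.

Lemma slope_le : exists2 Lam : R, 0 < Lam &
  forall i t, cedom i t -> branch_slope i t <= Lam.
Proof.
have [eps eps0 [C C0 HC]] := slope_holder.
have /choice[z Hz] i : exists z, cedom i z.
  by have [t Et] := edom_neq0 i; exists t; exact: subset_closure.
have [M M0 zM] := finite_bound (fun i => branch_slope i (z i)).
exists (M + C); first by rewrite addr_gt0.
move=> i t it; rewrite -[leLHS](subrK (branch_slope i (z i))) addrC lerD//.
  exact: le_trans (ler_norm _) (zM i).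
apply: le_trans (ler_norm _) _; apply: le_trans (HC i t (z i) it (Hz i)) _.
rewrite ler_piMr ?(ltW C0)//.
have /cedom_sub := it; have /cedom_sub := Hz i; rewrite /= !in_itv/= => /andP[? ?] /andP[? ?].
have {1}<- : 1 `^ eps = 1 :> R by rewrite powR1.
rewrite ge0_ler_powR ?nnegrE ?(ltW eps0)//.
by rewrite ler_norml; apply/andP; split; lra.
Qed.

Lemma ibranch_word_cat u v t :
  ibranch_word F (u ++ v) t = ibranch_word F u (ibranch_word F v t).
Proof. by elim: u => //= i u ->. Qed.

Lemma ibranch_word_in w t : `[0, 1]%classic t -> `[0, 1]%classic (ibranch_word F w t).
Proof. by move=> t01; elim: w => //= i w IH; apply/cedom_sub/ibranch_in. Qed.

Lemma ibranch_word_mono w :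
  (forall s t, `[0, 1]%classic s -> `[0, 1]%classic t ->
     (ibranch_word F w s <= ibranch_word F w t) = (s <= t)) \/
  (forall s t, `[0, 1]%classic s -> `[0, 1]%classic t ->
     (ibranch_word F w s <= ibranch_word F w t) = (t <= s)).
Proof.
elim: w => [|i w IH] /=; first by left.
have win := @ibranch_word_in w.
by have [h|h] := ibranch_mono i; have [k|k] := IH; [left|right|right|left] => s t s01 t01;
  rewrite h ?k//; exact: win.
Qed.

Definition piece w : set R := ibranch_word F w @` `[0, 1].

Definition piece_len w : R := `|ibranch_word F w 0 - ibranch_word F w 1|.

Lemma piece_sub w : piece w `<=` `[0, 1].
Proof. by move=> _ [t t01 <-]; exact: ibranch_word_in. Qed.

Lemma piece_cat u v : piece (u ++ v) `<=` piece u.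
Proof.
move=> _ [t t01 <-]; rewrite ibranch_word_cat.
by exists (ibranch_word F v t) => //; exact: ibranch_word_in.
Qed.

Lemma piece_cons_sub i w : piece (i :: w) `<=` cedom i.
Proof. by move=> _ [t t01 <-] /=; apply/ibranch_in/ibranch_word_in. Qed.

(** Surjectivity is obtained by applying the forward branch: a point between the end points lies in
    the closed domain of the first letter, and its image lies between the end points for the
    remaining word. *)
Lemma piece_betweenE w y :
  piece w y <-> between (ibranch_word F w 0) (ibranch_word F w 1) y.
Proof.
split.
  move=> [t /= + <-]; rewrite in_itv/= => t01; have /andP[t0 t1] := t01.
  have ut : `[0, 1]%classic t by rewrite /= in_itv.
  by rewrite /between; have [h|h] := ibranch_word_mono w; rewrite !h// t0 t1 ?orbT.
elim: w y => [|i w IH] y /=.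
  rewrite /between => /orP[|/andP[y1 y0]]; first by exists y; rewrite // in_itv.
  by have := le_trans y1 y0; rewrite leNgt ltr01.
move=> yb; have w0 := ibranch_word_in w unit_itv0; have w1 := ibranch_word_in w unit_itv1.
have yi : cedom i y.
  move: yb; rewrite /between => /orP[]; apply: cedom_interval; exact: ibranch_in.
have [t t01 ty] : piece w (branch F i y).
  by apply: IH; rewrite -(ibranch_between i w0 w1 (branch_in yi)) branchK.
by exists t; rewrite //= ty branchK.
Qed.

Lemma piece_diam w (s t : R) : piece w s -> piece w t -> `|s - t| <= piece_len w.
Proof.
rewrite /piece_len => /piece_betweenE + /piece_betweenE; rewrite /between.
set a := ibranch_word F w 0; set b := ibranch_word F w 1.
have := ler_norm (a - b); have := ler_norm (b - a); rewrite distrC ler_norml.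
by move=> ? ? /orP[] /andP[? ?] /orP[] /andP[? ?]; apply/andP; split; lra.
Qed.

Lemma piece_end0 w : piece w (ibranch_word F w 0).
Proof. by exists 0. Qed.

Lemma piece_end1 w : piece w (ibranch_word F w 1).
Proof. by exists 1. Qed.
Hint Resolve piece_end0 piece_end1 : core.

Lemma piece_side_by_side u v : size u = size v -> u != v -> side_by_side (piece u) (piece v).
Proof.
elim: u v => [|i u IH] [|j v]//= [uv] neq.
have [ij|ij] := eqVneq i j; last first.
  by apply: side_by_side_sub (cedom_side_by_side ij); exact: piece_cons_sub.
rewrite {}ij in neq *; have {}neq : u != v by apply: contra neq => /eqP->.
by have [h|h] := IH v uv neq; have [k|k] := ibranch_mono j; [left|right|right|left] => _ _
  [s s01 <-] [t t01 <-] /=; (rewrite k; [|exact: ibranch_word_in..]; apply: h; [exists s|exists t]).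
Qed.

Lemma piece_len_nil : piece_len [::] = 1.
Proof. by rewrite /piece_len /= sub0r normrN normr1. Qed.

(** The mean value theorem for the branch on the piece of [i :: w]. The location of t is recorded
    for the distortion estimate. *)
Lemma piece_len_cons i w : exists t, [/\ cedom i t,
  `|ibranch_word F (i :: w) 0 - t| <= piece_len (i :: w) &
  piece_len w = branch_slope i t * piece_len (i :: w)].
Proof.
have w0 := ibranch_word_in w unit_itv0; have w1 := ibranch_word_in w unit_itv1.
have [t [it tb E]] := MVT_within_norm (@cedom_interval i) (ibranch_in w0) (ibranch_in w1)
  (@branch_derivable i).
by exists t; split=> //; rewrite /piece_len /= -E !ibranchK.
Qed.

Lemma piece_len_bounds : exists lo hi : R, [/\ 0 < lo, 0 < hi < 1 &
  forall w, lo ^+ size w <= piece_len w <= hi ^+ size w].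
Proof.
have [lam lam1 Hlam] := slope_ge; have [Lam Lam0 HLam] := slope_le.
have lam0 : 0 < lam by rewrite (lt_trans ltr01).
exists Lam^-1, lam^-1; rewrite !invr_gt0 Lam0 lam0 invf_lt1// lam1; split=> //.
elim=> [|i w /andP[IH1 IH2]]; first by rewrite piece_len_nil lexx.
have [t [it _ E]] := piece_len_cons i w; rewrite E in IH1 IH2.
have l0 : 0 <= piece_len (i :: w) by exact: normr_ge0.
rewrite /= !exprS !ler_pdivrMl// ler_pdivlMl//; apply/andP; split.
  by rewrite (le_trans IH1)// ler_wpM2r// HLam.
by rewrite (le_trans _ IH2)// ler_wpM2r// Hlam.
Qed.

Lemma piece_len_small e : 0 < e ->
  exists n0, forall w, (n0 <= size w)%N -> piece_len w < e.
Proof.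
move=> e0; have [lo [hi [_ /andP[hi0 hi1] H]]] := piece_len_bounds.
have hi01 : 0 <= hi < 1 by rewrite ltW.
have e20 : 0 < e / 2 by rewrite divr_gt0.
have [n0 Hn0] := geometric_small hi01 ler01 e20.
exists n0 => w /Hn0; have /andP[_ /le_lt_trans] := H w; rewrite mul1r => lw wn; apply: lw.
by rewrite (le_lt_trans wn)//; lra.
Qed.

Lemma prefix_ofS x n : prefix_of x n.+1 = x 0%N :: prefix_of (left_shift x) n.
Proof. by rewrite /prefix_of /mkseq /= (iotaDl 1 0) -map_comp. Qed.

Lemma prefix_ofD x n k : prefix_of x (n + k) = prefix_of x n ++ prefix_of (iter n left_shift x) k.
Proof. by elim: n x => // n IH x; rewrite addSn !prefix_ofS IH iterSr. Qed.

Lemma size_prefix_of x n : size (prefix_of x n) = n.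
Proof. exact: size_mkseq. Qed.

(** The pieces are nested closed intervals, so the supremum of their left ends is a common point,
    and the choice made by [coding] is not the default value. *)
Lemma coding_in x n : piece (prefix_of x n) (coding F x).
Proof.
suff [z Hz] : exists z, (\bigcap_n piece (prefix_of x n)) z.
  have := xgetPex 0 (ex_intro _ z Hz); exact.
pose l n := Num.min (ibranch_word F (prefix_of x n) 0) (ibranch_word F (prefix_of x n) 1).
pose r n := Num.max (ibranch_word F (prefix_of x n) 0) (ibranch_word F (prefix_of x n) 1).
have pE k y : piece (prefix_of x k) y <-> l k <= y <= r k.
  by rewrite piece_betweenE betweenE.
have lr k : l k <= r k by rewrite /l /r ge_min le_max lexx.
have nest k d y : piece (prefix_of x (k + d)) y -> piece (prefix_of x k) y.
  by rewrite prefix_ofD; exact: piece_cat.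
have cross k j : l k <= r j.
  have [kj|/ltnW jk] := leqP k j.
    have /pE/andP[] : piece (prefix_of x k) (r j) by apply: (nest k (j - k)%N); rewrite subnKC//; apply/pE; rewrite lr lexx.
    by [].
  have /pE/andP[] : piece (prefix_of x j) (l k) by apply: (nest j (k - j)%N); rewrite subnKC//; apply/pE; rewrite lr lexx.
  by [].
have hs : has_sup (range l).
  split; first by exists (l 0%N), 0%N.
  by exists (r 0%N) => _ [k _ <-]; exact: cross.
exists (sup (range l)) => j _; apply/pE; apply/andP; split.
  by apply: ub_le_sup; [exact: hs.2|exists j].
by apply: ge_sup; [exact: hs.1|move=> _ [k _ <-]; exact: cross].
Qed.

Lemma coding_unit x : `[0, 1]%classic (coding F x).
Proof. exact: piece_sub (coding_in x 0). Qed.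

Lemma coding_cedom x : cedom (x 0%N) (coding F x).
Proof. by have := coding_in x 1; rewrite prefix_ofS => /piece_cons_sub. Qed.

Lemma coding_uniq x y : (forall n, piece (prefix_of x n) y) -> y = coding F x.
Proof.
move=> H; apply/eqP; rewrite -subr_eq0 -normr_eq0 eq_le normr_ge0 andbT.
apply/ler_addgt0Pr => e e0; rewrite add0r.
have [n0 Hn] := piece_len_small e0.
rewrite (le_trans (piece_diam (H n0) (coding_in x n0)))// ltW// Hn//.
by rewrite size_prefix_of.
Qed.

Lemma coding_shift x : coding F x = ibranch F (x 0%N) (coding F (left_shift x)).
Proof.
apply/esym/coding_uniq => -[|n].
  by exists (ibranch F (x 0%N) (coding F (left_shift x))) => //;
    exact/cedom_sub/ibranch_in/coding_unit.
rewrite prefix_ofS; have [t t01 <-] := coding_in (left_shift x) n.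
by exists t.
Qed.

Lemma branch_coding x : branch F (x 0%N) (coding F x) = coding F (left_shift x).
Proof. by rewrite coding_shift ibranchK//; exact: coding_unit. Qed.

End geometry.

Lemma ln_dist_le {R : realType} (a b : R) : 1 <= a -> 1 <= b -> `|ln a - ln b| <= `|a - b|.
Proof.
wlog ab : a b / a <= b.
  by move=> H a1 b1; have [|/ltW] := leP a b => ?; [|rewrite distrC [leRHS]distrC]; apply: H.
move=> a1 b1; have a0 : 0 < a by rewrite (lt_le_trans ltr01).
have b0 : 0 < b by rewrite (lt_le_trans ltr01).
rewrite distrC [leRHS]distrC !ger0_norm ?subr_ge0// ?ler_ln ?posrE//.
rewrite -ln_div ?posrE//; have -> : b / a = 1 + (b - a) / a by field; rewrite gt_eqF.
apply: (@le_trans _ _ ((b - a) / a)).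
  by apply: le_ln1Dx; rewrite (lt_le_trans (ltrN10 _))// divr_ge0 ?subr_ge0// ltW.
by rewrite ler_pdivrMr// ler_peMr// subr_ge0.
Qed.

(** * Birkhoff sums and cylinders *)

Section birkhoff.
Context {R : realType} {p : nat}.
Implicit Types (f : sigma p -> R) (x : sigma p) (w : word p).

Lemma birkhoffD n k f x :
  birkhoff (n + k) f x = birkhoff n f x + birkhoff k f (iter n left_shift x).
Proof.
rewrite /birkhoff (big_cat_nat (leq0n n) (leq_addr k n))/=; congr (_ + _).
rewrite -{1}[n]add0n big_addn addKn.
by apply: eq_bigr => i _; rewrite iterD.
Qed.

Lemma birkhoff0 f x : birkhoff 0 f x = 0.
Proof. by rewrite /birkhoff big_geq. Qed.

Lemma birkhoff1 f x : birkhoff 1 f x = f x.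
Proof. by rewrite /birkhoff big_nat1. Qed.

Lemma birkhoffS n f x : birkhoff n.+1 f x = f x + birkhoff n f (left_shift x).
Proof. by rewrite -add1n birkhoffD birkhoff1. Qed.

Lemma birkhoffZ n (a : R) f x : birkhoff n (fun y => a * f y) x = a * birkhoff n f x.
Proof. by rewrite /birkhoff mulr_sumr. Qed.

Lemma cylinder_neq0 w : cylinder w !=set0.
Proof.
exists (fun n => nth ord0 w n); rewrite /cylinder/= /prefix_of.
by apply: (@eq_from_nth _ ord0); rewrite size_mkseq// => n nw; rewrite nth_mkseq.
Qed.

Lemma cylinder_cons i w x : cylinder (i :: w) x <-> x 0%N = i /\ cylinder w (left_shift x).
Proof. by rewrite /cylinder /= prefix_ofS; split=> [[-> ->]|[-> ->]]. Qed.

Lemma cylinder_cat u v x :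
  cylinder (u ++ v) x <-> cylinder u x /\ cylinder v (iter (size u) left_shift x).
Proof.
rewrite /cylinder /= size_cat prefix_ofD; split=> [/eqP|[-> ->]//].
by rewrite eqseq_cat ?size_prefix_of// => /andP[/eqP ? /eqP ?].
Qed.

Lemma birkhoff_letters (X : 'I_p.+2 -> R) w x : cylinder w x ->
  birkhoff (size w) (fun y => X (y 0%N)) x = wsum X w.
Proof.
elim: w x => [|i w IH] x; first by rewrite birkhoff0 wsum_nil.
by move=> /cylinder_cons[<- xw]; rewrite /= birkhoffS wsum_cons IH.
Qed.

Lemma birkhoff_sup_letters (X : 'I_p.+2 -> R) w :
  birkhoff_sup w (fun y => X (y 0%N)) = wsum X w.
Proof.
rewrite /birkhoff_sup (_ : [set _ | _ in _] = [set wsum X w]) ?sup1//.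
apply/seteqP; split=> [_ [x xw <-]|_ ->]; first exact: birkhoff_letters.
by have [x xw] := cylinder_neq0 w; exists x => //; exact: birkhoff_letters.
Qed.

End birkhoff.

(** * Bounded distortion *)

Section distortion.
Variables (R : realType) (p : nat) (F : expanding_map R 'I_p.+2).
Implicit Types (x : sigma p) (w : word p).
Local Notation phi := (geom_potential F).
Local Notation ell := (piece_len F).

Lemma geom_potentialE x : phi x = - ln (branch_slope F (x 0%N) (coding F x)).
Proof. by []. Qed.

Lemma piece_len_gt0 w : 0 < ell w.
Proof.
have [lo [hi [lo0 _ /(_ w)/andP[H _]]]] := piece_len_bounds F.
by rewrite (lt_le_trans _ H)// exprn_gt0.
Qed.

(** Each letter contributes the difference of the logarithms of the slope at the coded point and at
    a mean value point. By the Hölder condition it is at most a power of the piece length, and these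
    errors form a geometric series. *)
Lemma bounded_distortion : exists2 D : R, 0 <= D & forall w x, cylinder w x ->
  ln (ell w) - D <= birkhoff (size w) phi x <= ln (ell w) + D.
Proof.
have [eps eps0 [C C0 HC]] := slope_holder F.
have [lam lam1 Hlam] := slope_ge F.
have [lo [hi [lo0 /andP[hi0 hi1] Hl]]] := piece_len_bounds F.
pose q := hi `^ eps.
have q0 : 0 < q by rewrite powR_gt0.
have q1 : q < 1.
  have {1}<- : 1 `^ eps = 1 :> R by rewrite powR1.
  by rewrite gt0_ltr_powR// nnegrE ltW.
(* The factor 2 arises because the coded point and the mean value point are each within one piece
   length of the same end point. *)
pose K := C * 2 `^ eps / (1 - q).
have K0 : 0 <= K by rewrite divr_ge0 ?subr_ge0 ?(ltW q1)// mulr_ge0 ?powR_ge0// ltW.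
(* Keeping the partial geometric sum in the bound is what lets the induction on the word close. *)
suff H w x : cylinder w x ->
    `|ln (ell w) - birkhoff (size w) phi x| <= K * (1 - q ^+ (size w).+1).
  exists K => // w x /H h; have {h} : `|ln (ell w) - birkhoff (size w) phi x| <= K.
    by rewrite (le_trans h)// ler_piMr// gerBl exprn_ge0// ltW.
  by rewrite ler_norml => /andP[? ?]; apply/andP; split; lra.
elim: w x => [|i w IH] x.
  rewrite piece_len_nil ln1 birkhoff0 subrr normr0 mulr_ge0// subr_ge0 expr1 ltW//.
move=> /cylinder_cons[xi xw].
have [t [it th E]] := piece_len_cons F i w.
have sl1 u : cedom F i u -> 1 <= branch_slope F i u.
  by move=> iu; rewrite (le_trans (ltW lam1))// Hlam.
have xc : cedom F i (coding F x) by rewrite -xi; exact: coding_cedom.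
have ln_sl : ln (ell w) = ln (branch_slope F i t) + ln (ell (i :: w)).
  by rewrite E lnM ?posrE ?piece_len_gt0// (lt_le_trans ltr01)// sl1.
rewrite /= birkhoffS geom_potentialE xi.
have -> : ln (ell (i :: w)) - (- ln (branch_slope F i (coding F x)) + birkhoff (size w) phi (left_shift x)) =
  (ln (ell w) - birkhoff (size w) phi (left_shift x)) +
  (ln (branch_slope F i (coding F x)) - ln (branch_slope F i t)).
  by rewrite ln_sl; ring.
apply: le_trans (ler_normD _ _) _.
set n := size w.
have -> : K * (1 - q ^+ n.+2) = K * (1 - q ^+ n.+1) + C * (2 `^ eps * q ^+ n.+1).
  by rewrite /K !exprS; field; rewrite subr_eq0 gt_eqF.
rewrite lerD ?IH// (le_trans (ln_dist_le _ _)) ?sl1// (le_trans (HC _ _ _ _ _))//.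
rewrite ler_wpM2l ?(ltW C0)//.
have -> : q ^+ n.+1 = (hi ^+ n.+1) `^ eps.
  by rewrite /q -powR_mulrn ?powR_ge0// powRAC powR_mulrn// ltW.
rewrite -powRM ?exprn_ge0 ?(ltW hi0)//.
rewrite ge0_ler_powR ?nnegrE ?mulr_ge0 ?exprn_ge0 ?(ltW eps0) ?(ltW hi0)//.
have pin : piece F (i :: w) (coding F x).
  have := coding_in F x (size w).+1; rewrite prefix_ofS xi.
  by have -> : prefix_of (left_shift x) (size w) = w by exact: xw.
have := piece_diam pin (piece_end0 F (i :: w)).
have /andP[_] := Hl (i :: w); rewrite -/n => h1 h2.
have -> : coding F x - t = (coding F x - ibranch_word F (i :: w) 0) + (ibranch_word F (i :: w) 0 - t) by ring.
by rewrite (le_trans (ler_normD _ _))// mulrDl mul1r lerD// (le_trans _ h1).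
Qed.

(** Birkhoff sums are exactly additive along a concatenation; replacing the three sums by logarithms
    of lengths costs D each. *)
Lemma piece_len_quasi_mul : exists2 C : R, 1 <= C & forall u v,
  ell (u ++ v) <= C * (ell u * ell v) /\ ell u * ell v <= C * ell (u ++ v).
Proof.
have [D D0 bd] := bounded_distortion.
exists (expR (3 * D)); first by rewrite -expR0 ler_expR mulr_ge0.
move=> u v; have [x xw] := cylinder_neq0 (u ++ v).
have [xu xv] := (cylinder_cat _ _ _).1 xw.
have /andP[h1 h2] := bd _ _ xu; have /andP[h3 h4] := bd _ _ xv.
have := bd _ _ xw; rewrite size_cat birkhoffD => /andP[h5 h6].
have e w : ell w = expR (ln (ell w)) by rewrite lnK// posrE piece_len_gt0.
by rewrite (e (u ++ v)) (e u) (e v) -!expRD !ler_expR; split; lra.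
Qed.

Lemma expR_birkhoff_sup (s : R) : 0 <= s -> exists2 C : R, 0 < C & forall w,
  ell w `^ s <= C * expR (s * birkhoff_sup w phi) /\
  expR (s * birkhoff_sup w phi) <= C * ell w `^ s.
Proof.
move=> s0; have [D _ bd] := bounded_distortion.
exists (expR (s * D)); first exact: expR_gt0.
move=> w; rewrite /powR gt_eqF ?piece_len_gt0// -!expRD !ler_expR.
have [x xw] := cylinder_neq0 w.
have ub : birkhoff_sup w phi <= ln (ell w) + D.
  apply: ge_sup; first by exists (birkhoff (size w) phi x), x.
  by move=> _ [y /bd/andP[_ ?] <-].
have lb : ln (ell w) - D <= birkhoff_sup w phi.
  have /andP[h _] := bd w x xw; apply: le_trans h _.
  apply: ub_le_sup; last by exists x.
  by exists (ln (ell w) + D) => _ [y /bd/andP[_ ?] <-].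
by rewrite -!mulrDr !ler_wpM2l//; lra.
Qed.

End distortion.

(** * Cylinder masses and dynamics of the lift *)

Section cylinder_measure.
Variables (R : realType) (p : nat) (mu : probability (borel_sigma R p) R).
Implicit Types (w : word p) (i : 'I_p.+2).

Lemma cylinder_open w : @sigma_open R p (cylinder w).
Proof.
move=> x xw; exists (expR (- (size w)%:R)); first exact: expR_gt0.
move=> y /inf_lt[]; first by exists (expR (- 0%:R)), 0%N.
move=> _ [k /= xy <-]; rewrite ltr_expR ltrN2 ltr_nat => wk.
rewrite /cylinder /= -[RHS]xw /=.
by move: xy; rewrite -(subnKC (ltnW wk)) !prefix_ofD => /eqP;
  rewrite eqseq_cat ?size_prefix_of// => /andP[/eqP->].
Qed.

Lemma measurable_cylinder w : measurable (cylinder w : set (borel_sigma R p)).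
Proof. by apply: sub_sigma_algebra; exact: cylinder_open. Qed.

Definition cyl_mass w : R := fine (mu (cylinder w)).

Lemma cyl_massE w : mu (cylinder w) = (cyl_mass w)%:E.
Proof. by rewrite /cyl_mass fineK// fin_num_measure//; exact: measurable_cylinder. Qed.

Lemma cyl_mass_ge0 w : 0 <= cyl_mass w.
Proof. by rewrite /cyl_mass fine_ge0. Qed.

Lemma cyl_mass_nil : cyl_mass [::] = 1.
Proof.
rewrite /cyl_mass (_ : cylinder [::] = setT) ?probability_setT//.
by apply/seteqP; split=> // x _; rewrite /cylinder.
Qed.

Lemma cyl_mass_partition (f : 'I_p.+2 -> word p) (B : set (sigma p)) :
  (forall x, B x <-> exists i, cylinder (f i) x) ->
  (forall i j x, cylinder (f i) x -> cylinder (f j) x -> i = j) ->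
  mu B = (\sum_i cyl_mass (f i))%:E.
Proof.
move=> BE fd.
have -> : B = \big[setU/set0]_(i < p.+2) cylinder (f i).
  rewrite -bigcup_mkord_ord; apply/seteqP; split=> x.
    by move=> /BE[i xi]; exists (val i); [exact: ltn_ord|rewrite /= inord_val].
  by move=> [k _ xk]; apply/BE; eexists; exact: xk.
rewrite measure_bigsetU_ord.
- by rewrite -sumEFin; apply: eq_bigr => i _; exact: cyl_massE.
- by move=> i; exact: measurable_cylinder.
- by move=> i j _ _ [x [xi xj]]; exact: fd xi xj.
Qed.

Lemma cylinder_rcons w i x :
  cylinder (w ++ [:: i]) x <-> cylinder w x /\ x (size w) = i.
Proof.
rewrite cylinder_cat; split=> -[xw].
  rewrite cylinder_cons => -[<- _]; split=> //.
  by elim: (size w) x {xw} => // n IH x; rewrite iterSr -IH.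
move=> <-; split=> //; rewrite cylinder_cons; split=> //.
by elim: (size w) x {xw} => // n IH x; rewrite iterSr IH.
Qed.

Lemma cyl_mass_rcons w : \sum_i cyl_mass (w ++ [:: i]) = cyl_mass w.
Proof.
apply: EFin_inj; rewrite -cyl_massE; apply/esym/cyl_mass_partition.
  move=> x; split=> [xw|[i /cylinder_rcons[]//]].
  by exists (x (size w)); apply/cylinder_rcons.
by move=> i j x /cylinder_rcons[_ <-] /cylinder_rcons[_ <-].
Qed.

Hypothesis mu_inv : forall B : set (borel_sigma R p), measurable B ->
  mu (left_shift @^-1` B) = mu B.

Lemma cyl_mass_cons w : \sum_i cyl_mass (i :: w) = cyl_mass w.
Proof.
apply: EFin_inj; rewrite -cyl_massE -mu_inv; last exact: measurable_cylinder.
apply/esym/cyl_mass_partition.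
  move=> x; split=> [xw|[i /cylinder_cons[]//]].
  by exists (x 0%N); apply/cylinder_cons.
by move=> i j x /cylinder_cons[<- _] /cylinder_cons[<- _].
Qed.

Lemma integral_letters (X : 'I_p.+2 -> R) :
  (\int[mu]_x (X (x 0%N))%:E = (\sum_i cyl_mass [:: i] * X i)%:E)%E.
Proof.
have mc i := measurable_cylinder [:: i].
transitivity (\int[mu]_x (\sum_i (X i)%:E * (\1_(cylinder [:: i] : set (borel_sigma R p)) x)%:E)%E)%E.
  apply: eq_integral => x _; rewrite (bigD1 (x 0%N))//= big1 ?adde0.
    by rewrite indicE mem_set ?mule1//; apply/cylinder_cons.
  move=> i ix; rewrite indicE memNset ?mule0//.
  by move=> /cylinder_cons[xi _]; rewrite xi eqxx in ix.
have ii i := integrable_indic mu (mc i).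
rewrite integral_sum//; last by move=> i; apply: integrableZl.
rewrite -sumEFin; apply: eq_bigr => i _.
by rewrite integralZl// integral_indic// setIT [X in (_ * X)%E]cyl_massE -EFinM mulrC.
Qed.

End cylinder_measure.

(** * Orbits of the lift *)

Section dynamics.
Variables (R : realType) (p : nat) (F : expanding_map R 'I_p.+2) (Psi : R -> int).
Hypothesis Psi_const : forall i x y, edom F i x -> edom F i y -> Psi x = Psi y.
Implicit Types (x : sigma p) (w : word p).

Lemma endpoints_shift x : endpoints F (coding F (left_shift x)) -> endpoints F (coding F x).
Proof.
move=> [w _ [t t01 tE]]; exists (x 0%N :: w) => //; exists t => //.
by rewrite coding_shift -tE.
Qed.

Lemma endpoints_iter x n : ~ endpoints F (coding F x) ->
  ~ endpoints F (coding F (iter n left_shift x)).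
Proof. by move=> xD; elim: n => //= n IH /endpoints_shift. Qed.

Lemma endpoints0 t : t = 0 \/ t = 1 -> endpoints F t.
Proof. by move=> [] ->; exists [::] => //; [exists 0; [left|]|exists 1; [right|]]. Qed.

Lemma coding_open x : ~ endpoints F (coding F x) -> 0 < coding F x < 1.
Proof.
move=> xD; have := coding_unit F x; rewrite /= in_itv/= => /andP[x0 x1].
by rewrite !lt_neqAle x0 x1 !andbT; apply/andP; split; apply/eqP => h; apply: xD; apply: endpoints0; [left|right].
Qed.

(* Off the end points, [coding F x] lies strictly between two points of
   [cedom F (x 0)], hence in the domain itself and not only in its closure. *)
Lemma coding_edom x : ~ endpoints F (coding F x) -> edom F (x 0%N) (coding F x).
Proof.
move=> xD; set i := x 0%N.
have [a [b [ai bi ab]]] : exists a b, [/\ cedom F i a, cedom F i b & a < coding F x < b].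
  have := piece_betweenE F [:: i] (coding F x).
  have -> : [:: i] = prefix_of x 1 by rewrite prefix_ofS.
  move=> [/(_ (coding_in F x 1)) + _]; rewrite prefix_ofS /=.
  have e0 : ibranch F i 0 != coding F x.
    by apply/eqP => h; apply: xD; exists [:: i] => //; exists 0 => //; left.
  have e1 : ibranch F i 1 != coding F x.
    by apply/eqP => h; apply: xD; exists [:: i] => //; exists 1 => //; right.
  rewrite /between => /orP[] /andP[h0 h1].
    exists (ibranch F i 0), (ibranch F i 1); split; rewrite ?lt_neqAle ?e0 ?h0 ?h1 1?eq_sym ?e1//.
    - exact/ibranch_in/unit_itv0.
    - exact/ibranch_in/unit_itv1.
  exists (ibranch F i 1), (ibranch F i 0); split; rewrite ?lt_neqAle ?e1 ?h0 ?h1 1?eq_sym ?e0//.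
  - exact/ibranch_in/unit_itv1.
  - exact/ibranch_in/unit_itv0.
have /andP[ac cb] := ab.
have near (z e : R) : cedom F i z -> 0 < e -> exists2 y, edom F i y & `|z - y| < e.
  move=> zi e0; have [y [Ey yz]] := zi _ (nbhsx_ballx z e e0).
  by exists y.
have [a' Ea a'a] := near a (coding F x - a) ai ltac:(by rewrite subr_gt0).
have [b' Eb b'b] := near b (b - coding F x) bi ltac:(by rewrite subr_gt0).
apply: (edom_interval Ea Eb); move: a'a b'b.
by rewrite !ltr_norml => /andP[? ?] /andP[? ?]; apply/andP; split; lra.
Qed.

Lemma step_length_coding x : ~ endpoints F (coding F x) ->
  Psi (coding F x) = step_length F Psi x.
Proof.
move=> /coding_edom xE; apply: (Psi_const xE).
exact: (xgetPex 0 (ex_intro _ _ xE)).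
Qed.

(** Off the end points the coded point lies strictly between 0 and 1, so only the summand of index k
    survives. *)
Lemma psi_lift_coding x (k : int) : ~ endpoints F (coding F x) ->
  psi_lift F Psi (coding F x + k%:~R) =
  coding F (left_shift x) + (k + step_length F Psi x)%:~R.
Proof.
move=> xD; have /andP[c0 c1] := coding_open xD.
rewrite /psi_lift -(@fsbig_widen _ _ _ _ [set k])//; last first.
  move=> j [_ /= jk]; apply/eqP; rewrite mulf_eq0; apply/orP; right.
  rewrite indicE memNset// /= in_itv/= -addrA -intrB => /andP[h0 h1].
  have : -1 < ((k - j)%:~R : R) < 1 by apply/andP; split; lra.
  have -> : (-1 : R) = (-1)%:~R by [].
  have -> : (1 : R) = (1%Z)%:~R by [].
  rewrite !ltr_int => /andP[l1 l2]; apply: jk; apply/esym/eqP.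
  rewrite -subr_eq0; apply/eqP; lia.
rewrite fsbig_set1 addrK indicE mem_set ?mulr1; last by exact: coding_unit.
rewrite step_length_coding// -(branchE (coding_edom xD)) branch_coding.
by rewrite intrD; ring.
Qed.

Lemma iter_psi_lift x (k : int) n : ~ endpoints F (coding F x) ->
  iter n (psi_lift F Psi) (coding F x + k%:~R) =
  coding F (iter n left_shift x) + k%:~R
    + birkhoff n (fun y => (step_length F Psi y)%:~R) x.
Proof.
move=> xD; suff -> : iter n (psi_lift F Psi) (coding F x + k%:~R) =
    coding F (iter n left_shift x) +
    (k + \sum_(0 <= j < n) step_length F Psi (iter j left_shift x))%:~R.
  by rewrite intrD -addrA /birkhoff rmorph_sum.
elim: n => [|n IH]; first by rewrite big_geq//= addr0.
rewrite iterS IH psi_lift_coding; last exact: endpoints_iter.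
by rewrite big_nat_recr//= addrA.
Qed.

Lemma endpoints_null s : 0 < s -> hausdorff_null s (endpoints F).
Proof.
move=> s0; have -> : endpoints F =
    \bigcup_(q : word p * bool) [set ibranch_word F q.1 (if q.2 then 1 else 0)].
  apply/seteqP; split=> t.
    by move=> [w _ [u [->|->] <-]]; [exists (w, false)|exists (w, true)].
  by move=> [[w b] _ /= ->]; exists w => //; eexists; last by []; case: b; [right|left].
by apply: hausdorff_null_bigcup => q; exact: hausdorff_null_set1.
Qed.

End dynamics.

(** * Dimensions *)

Section lift_dimension.
Variables (R : realType) (p : nat) (F : expanding_map R 'I_p.+2) (Psi : R -> int).
Hypothesis Psi_const : forall i x y, edom F i x -> edom F i y -> Psi x = Psi y.
Variables (delta : R) (delta_gt0 : 0 < delta).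
Hypothesis delta_bowen : pressure (fun x => delta * geom_potential F x) = 0.
Variable mu : probability (borel_sigma R p) R.
Hypothesis mu_gibbs : gibbs_measure (fun x => delta * geom_potential F x) mu.
Implicit Types (x : sigma p) (w : word p).
Local Notation phi := (geom_potential F).
Local Notation ell := (piece_len F).
Local Notation m := (cyl_mass mu).

(** With pressure 0 the Gibbs property compares the mass with [expR (delta * S_n phi)], and bounded
    distortion turns this into [ell ^ delta]. *)
Lemma gibbs_piece_len : exists2 c : R, 0 < c & forall w,
  m w <= c * ell w `^ delta /\ ell w `^ delta <= c * m w.
Proof.
have [_ [c c1 Hc]] := mu_gibbs; have [D _ HD] := bounded_distortion F.
have c0 : 0 < c by rewrite (lt_le_trans ltr01).
exists (c * expR (delta * D)); first by rewrite mulr_gt0 ?expR_gt0.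
move=> w; have [x xw] := cylinder_neq0 w.
have := Hc _ (in_tuple w) x xw.
rewrite delta_bowen mulr0 subr0 birkhoffZ /= -/(m w).
have := HD w x xw; set b := birkhoff _ _ _ => /andP[h1 h2].
rewrite ler_pdivlMr ?expR_gt0// ler_pdivrMr ?expR_gt0// ler_pdivrMl// => /andP[g1 g2].
rewrite /powR gt_eqF ?piece_len_gt0//; split.
  rewrite (le_trans g2)// -mulrA ler_wpM2l ?(ltW c0)// -expRD ler_expR -mulrDr.
  by rewrite ler_wpM2l ?(ltW delta_gt0)//; lra.
rewrite mulrAC [leRHS]mulrC; apply: le_trans (_ : expR (delta * D) * expR (delta * b) <= _).
  rewrite -expRD ler_expR -mulrDr.
  by rewrite ler_wpM2l ?(ltW delta_gt0)//; lra.
by rewrite ler_wpM2l ?expR_ge0.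
Qed.

Lemma gibbs_weights_exist : exists lo hi C c kap,
  gibbs_weights m ell lo hi C c kap delta.
Proof.
have [lo [hi [lo0 hi01 Hl]]] := piece_len_bounds F.
have [C C1 HC] := piece_len_quasi_mul F; have [c c0 Hc] := gibbs_piece_len.
have C0 : 0 < C by rewrite (lt_le_trans ltr01).
have Cd : 0 < C `^ delta by rewrite powR_gt0.
(* The constant [kap] comes from passing from both masses to lengths (c twice), joining the lengths
   ([C ^ delta]) and returning to the mass (c once more). *)
exists lo, hi, C, c, ((c * (C `^ delta * (c * c)))^-1); split => //.
- exact: cyl_mass_ge0.
- exact: cyl_mass_nil.
- exact: cyl_mass_rcons.
- exact: (cyl_mass_cons mu_gibbs.1).
- move=> u v; rewrite ler_pdivrMl ?mulr_gt0//.
  have e0 w : 0 <= ell w by rewrite ltW// piece_len_gt0.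
  apply: (@le_trans _ _ ((c * ell u `^ delta) * (c * ell v `^ delta))).
    by rewrite ler_pM ?cyl_mass_ge0// ?(Hc _).1.
  apply: (@le_trans _ _ ((c * c) * (C * ell (u ++ v)) `^ delta)).
    rewrite mulrACA -powRM// ler_wpM2l ?mulr_ge0 ?(ltW c0)//.
    by rewrite ge0_ler_powR ?nnegrE ?mulr_ge0 ?(ltW delta_gt0) ?(ltW C0)// (HC _ _).2.
  rewrite powRM ?(ltW C0)// mulrA.
  have -> : c * (C `^ delta * (c * c)) * m (u ++ v) = c * c * C `^ delta * (c * m (u ++ v)) by ring.
  by rewrite ler_wpM2l ?(Hc _).2// !mulr_ge0 ?(ltW c0)// ltW.
- by move=> w; have /andP[] := Hl w.
- by move=> w; have /andP[] := Hl w.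
- by move=> u v; have [] := HC u v.
- by move=> u v; have [] := HC u v.
- by move=> w; have [] := Hc w.
- by move=> w; have [] := Hc w.
- by rewrite invr_gt0 !mulr_gt0.
Qed.

Definition mean (X : 'I_p.+2 -> R) : R := \sum_i m [:: i] * X i.

Definition step_letter (i : 'I_p.+2) : R := (Psi (xget 0 (edom F i)))%:~R.

Lemma integral_step_length :
  (\int[mu]_x ((step_length F Psi x)%:~R)%:E = (mean step_letter)%:E)%E.
Proof. exact: (integral_letters mu step_letter). Qed.

Lemma mean_sub alpha : mean (fun i => step_letter i - alpha) = mean step_letter - alpha.
Proof.
rewrite /mean; under eq_bigr do rewrite mulrBr.
rewrite sumrB -mulr_suml; have := cyl_mass_rcons mu [::].
by rewrite cyl_mass_nil /= => ->; rewrite mul1r.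
Qed.

Lemma words_nearE alpha K : words_near F Psi alpha K =
  [set w | `|wsum (fun i => step_letter i - alpha) w| <= K].
Proof.
by apply/seteqP; split=> w; rewrite /words_near /=
  (birkhoff_sup_letters (fun i => step_letter i - alpha)).
Qed.

Lemma poincare_summable alpha K s C q : 0 <= s -> 0 <= C -> 0 < q < 1 ->
  (forall n, \sum_(w <- words 'I_p.+2 n | `|wsum (fun i => step_letter i - alpha) w| <= K)
     ell w `^ s <= C * q ^+ n) ->
  (\esum_(w in words_near F Psi alpha K) (expR (s * birkhoff_sup w phi))%:E < +oo)%E.
Proof.
move=> s0 C0 q01 H; have [c c0 Hc] := expR_birkhoff_sup F s0.
have H' n : \sum_(w <- words 'I_p.+2 n | `|wsum (fun i => step_letter i - alpha) w| <= K)
     c * ell w `^ s <= c * C * q ^+ n.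
  by rewrite -mulr_sumr -mulrA ler_wpM2l// ltW.
have := @esum_words_geometric _ _ (fun w => `|wsum (fun i => step_letter i - alpha) w| <= K)
  (fun w => c * ell w `^ s) (c * C) q 0 _ _ q01 H'.
move=> /(_ _ _)/le_lt_trans h; apply: le_lt_trans (h _ _ _ _); last exact: ltry.
- rewrite words_nearE.
  have -> : [set w | (`|wsum (fun i => step_letter i - alpha) w| <= K) /\ (0 <= size w)%N] =
     [set w | `|wsum (fun i => step_letter i - alpha) w| <= K].
    by apply/seteqP; split=> [w []//|w].
  by apply: le_esum => w _; rewrite lee_fin (Hc w).2.
- by move=> w; rewrite mulr_ge0 ?powR_ge0// ltW.
- by rewrite mulr_ge0// ltW.
Qed.

Lemma esum_ge_words (P : pred (word p)) (f : word p -> R) n : (forall w, 0 <= f w) ->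
  ((\sum_(w <- words 'I_p.+2 n | P w) f w)%:E <= \esum_(w in [set w | P w]) (f w)%:E)%E.
Proof.
move=> f0; apply: esum_ge.
exists [set` [seq w <- words 'I_p.+2 n | P w]].
  by split=> [|w /=]; [exact: finite_seq|rewrite mem_filter => /andP[]].
rewrite -fsbig_seq ?filter_uniq ?words_uniq//= big_filter sumEFin lexx//.
Qed.

(** [K0] bounds the letters of psi - alpha, the range to which correcting words bring a sum back.
    Above delta the series over all words converges. If the mean differs from alpha,
    [near_words_decay] gives convergence at some s < delta for every K; otherwise
    [near_words_unbounded] excludes it. *)
Lemma poincare_exponentP alpha : exists2 K0 : R, 0 < K0 & forall K : R, K0 <= K ->
  poincare_exponent F Psi alpha K = delta <-> mean step_letter = alpha.
Proof.
have [K0 K00 HK0] := finite_bound (fun i => step_letter i - alpha).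
have [lo [hi [C' [c' [kap W]]]]] := gibbs_weights_exist.
exists K0 => // K K0K.
set S := [set s | 0 <= s /\ (\esum_(w in words_near F Psi alpha K)
  (expR (s * birkhoff_sup w phi))%:E < +oo)%E].
have S0 : lbound S 0 by move=> s [].
have Sd s : delta < s -> S s.
  move=> ds; split; first by rewrite ltW// (lt_trans delta_gt0).
  have [q [q01 H]] := sum_ell_supercritical W ds.
  apply: (poincare_summable _ (ltW (weights_c W)) q01); first by rewrite ltW// (lt_trans delta_gt0).
  move=> n; apply: le_trans (H n); rewrite big_mkcond; apply: ler_sum => w _.
  by case: ifP => //; rewrite powR_ge0.
rewrite /poincare_exponent -/S; split=> [Sinf|mean_alpha].
  apply/eqP; rewrite -subr_eq0 -mean_sub; apply: contraPT Sinf => /(near_words_decay W)[s /andP[s0 sd] H].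
  have [C [q [C0 q01 HC]]] := H K.
  have Ss : S s by split => //; exact: (poincare_summable s0 C0 q01 HC).
  apply/eqP; rewrite lt_eqF// (le_lt_trans _ sd)//.
  by apply: ge_inf => //; exists 0.
apply/eqP; rewrite eq_le; apply/andP; split.
  apply/ler_addgt0Pr => e e0; apply: ge_inf; first by exists 0.
  by apply: Sd; rewrite ltrDl.
apply: lb_le_inf.
  by exists (delta + 1); apply: Sd; rewrite ltrDl.
move=> s [s0 Hs]; rewrite leNgt; apply/negP => sd.
have X0 : mean (fun i => step_letter i - alpha) = 0 by rewrite mean_sub mean_alpha subrr.
have [c c0 Hc] := expR_birkhoff_sup F s0.
move: Hs; set S' := esum _ _ => S'oo.
have S'0 : (0 <= S')%E by apply: esum_ge0 => w _; rewrite lee_fin expR_ge0.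
have S'fin : S' \is a fin_num by rewrite ge0_fin_numE.
have sd' : 0 <= s < delta by rewrite s0.
(* The words of the single length N already contribute at least S' + 1 to the supposedly finite sum
   S'. *)
have [N N0 HN] := near_words_unbounded W HK0 X0 sd' (c * (fine S' + 1)).
have H00 : `|0 : R| <= K0 by rewrite normr0 ltW.
have := HN 0 H00.
rewrite -ler_pdivlMl// leNgt => /negP; apply.
rewrite -lte_fin EFinD fineK// mulr_sumr.
apply: (@le_lt_trans _ _ S'); last by rewrite lte_spaddre// ltr01.
apply: le_trans (_ : (\sum_(w <- words 'I_p.+2 N | `|wsum (fun i => step_letter i - alpha) w| <= K)
    expR (s * birkhoff_sup w phi))%:E <= _)%E; last first.
  rewrite /S' words_nearE; apply: (esum_ge_words (fun w => `|wsum (fun i => step_letter i - alpha) w| <= K)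
    (f := fun w => expR (s * birkhoff_sup w phi))) => w.
  exact: expR_ge0.
rewrite lee_fin big_mkcond [leRHS]big_mkcond; apply: ler_sum => w _; rewrite add0r.
case: ifPn => [wK0|_]; last by case: ifP; rewrite // expR_ge0.
by rewrite (le_trans wK0 K0K) ler_pdivrMl// (Hc w).1.
Qed.

Lemma coding_limsup_null (P : pred (word p)) s C q (k : int) :
  0 <= s -> 0 <= C -> 0 < q < 1 ->
  (forall n, \sum_(w <- words 'I_p.+2 n | P w) ell w `^ s <= C * q ^+ n) ->
  hausdorff_null s [set coding F x + k%:~R | x in
    [set x | forall N, exists2 n, (N <= n)%N & P (prefix_of x n)]].
Proof.
move=> s0 C0 q01 H; have [lo [hi [C' [c [kap W]]]]] := gibbs_weights_exist.
apply: (@hausdorff_null_limsup _ _ (fun w => [set t + k%:~R | t in piece F w]) ell hi C q s P) => //.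
- exact: (weights_hi W).
- exact: (len_le W).
- move=> w _ _ [t wt <-] [u wu <-].
  have -> : t + k%:~R - (u + k%:~R) = t - u by ring.
  exact: piece_diam.
move=> _ [x Px <-] N; have [n Nn Pn] := Px N.
exists (prefix_of x n); split => //; first by rewrite size_prefix_of.
by exists (coding F x) => //; exact: coding_in.
Qed.

Lemma dim_lift_dom_le : (hausdorff_dim (lift_dom F) <= delta%:E)%E.
Proof.
apply/lee_addgt0Pr => e e0; rewrite -EFinD.
have ds : delta < delta + e by rewrite ltrDl.
have s0 : 0 <= delta + e by rewrite addr_ge0// ltW.
apply: hausdorff_dim_le => //.
have [lo [hi [C [c [kap W]]]]] := gibbs_weights_exist.
have [q [q01 H]] := sum_ell_supercritical W ds.
apply: (hausdorff_null_sub (E' := \bigcup_k [set coding F x + k%:~R | x in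
    [set x | forall N, exists2 n, (N <= n)%N & predT (prefix_of x n)]])).
  move=> _ [[t k] [[[x _ /= <-] _] _] <-] /=; exists k => //; exists x => // N.
  by exists N.
by apply: hausdorff_null_bigcup => k; exact: (coding_limsup_null k s0 (ltW (weights_c W)) q01 H).
Qed.

Lemma birkhoff_step_length n x :
  birkhoff n (fun y => (step_length F Psi y)%:~R) x = wsum step_letter (prefix_of x n).
Proof.
rewrite -(birkhoff_letters step_letter (x := x)) ?size_prefix_of//.
by rewrite /cylinder /= size_prefix_of.
Qed.

(** The recurrent set lies in a countable union, over integer translations and integer bounds, of
    limsup sets of words with bounded letter sum; all have decay at the same s. *)
Lemma dim_recurrent_lt : mean step_letter != 0 ->
  exists2 s, s < delta & (hausdorff_dim (recurrent_set F Psi) <= s%:E)%E.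
Proof.
have [lo [hi [C' [c [kap W]]]]] := gibbs_weights_exist.
move=> /(near_words_decay W)[s /andP[s0 sd] H]; exists s => //; apply: hausdorff_dim_le => //.
apply: (hausdorff_null_sub (E' := \bigcup_(j : int * nat) [set coding F x + j.1%:~R | x in
    [set x | forall N, exists2 n, (N <= n)%N & `|wsum step_letter (prefix_of x n)| <= j.2%:R]])).
  move=> _ [[[t k] [[[x _ /= <-] xD] _] <-] [K HK]].
  (* The orbit point is the coded point plus k plus the letter sum, and the coded point adds less
     than 1. *)
  exists (k, (Num.truncn (K + `|k%:~R| + 1)).+1) => //=; exists x => // N.
  have [n Nn h] := HK N; exists n => //; move: h; rewrite /= iter_psi_lift//.
  rewrite birkhoff_step_length; set z := wsum _ _ => h.
  have /andP[c0 c1] := coding_open (endpoints_iter (n := n) xD).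
  apply: le_trans (ltW (truncnS_gt _)); move: h.
  have := ler_norm (k%:~R : R); have := ler_norm (- k%:~R : R); rewrite normrN.
  by move=> ? ?; rewrite !ler_norml => /andP[? ?]; apply/andP; split; lra.
apply: hausdorff_null_bigcup => -[k K] /=; have [C [q [C0 q01 HC]]] := H K%:R.
exact: (@coding_limsup_null (fun w => `|wsum step_letter w| <= K%:R) _ _ _ k s0 C0 q01 HC).
Qed.

Definition bounded_orbits (X : 'I_p.+2 -> R) : set (sigma p) :=
  [set x | exists K, forall n, `|wsum X (prefix_of x n)| <= K].

(** Applies the tree argument to words whose letter sum is at most M in absolute value, with blocks
    of the length N given by [near_words_unbounded]. *)
Lemma bounded_orbits_not_null X s : mean X = 0 -> 0 < s < delta ->
  ~ hausdorff_null s (coding F @` bounded_orbits X).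
Proof.
move=> X0 /andP[s0 sd]; have [M M0 XM] := finite_bound X.
have [lo [hi [C [c [kap W]]]]] := gibbs_weights_exist.
have C0 := lt_le_trans ltr01 (weights_C W).
have e0 w : 0 <= ell w by rewrite ltW// piece_len_gt0.
have sd' : 0 <= s < delta by rewrite (ltW s0).
(* The factor 2 is the doubling asked of the tree, and [C ^ s] pays for splitting [ell (u ++ b)]. N
   serves all nodes u since the bound is uniform in the offset. *)
have [N N0 HN] := near_words_unbounded W XM X0 sd' (2 * C `^ s).
pose T w := `|wsum X w| <= M.
have lo1 : lo <= 1.
  have := len_ge W [:: ord0]; have := len_le W [:: ord0]; rewrite /= !expr1.
  by move=> h1 h2; rewrite (le_trans h2)// (le_trans h1)// ltW//; case/andP: (weights_hi W).
have rho_child u b : size b = N -> C^-1 * lo ^+ N * ell u <= ell (u ++ b).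
  move=> bN; rewrite -mulrA ler_pdivrMl// (le_trans _ (len_cat_ge W u b))//.
  by rewrite mulrC ler_wpM2l// -bN (len_ge W).
have T_sum u : T u ->
    2 * ell u `^ s <= \sum_(b <- words 'I_p.+2 N | T (u ++ b)) ell (u ++ b) `^ s.
  move=> Tu; apply: le_trans (_ : \sum_(b <- words 'I_p.+2 N | `|wsum X u + wsum X b| <= M)
      (C `^ s)^-1 * ell u `^ s * ell b `^ s <= _).
    rewrite -mulr_sumr mulrC -mulrA mulrCA ler_wpM2l ?powR_ge0//.
    by rewrite ler_pdivlMl ?powR_gt0// mulrC HN.
  rewrite big_mkcond [leRHS]big_mkcond; apply: ler_sum => b _.
  rewrite /T wsum_cat; case: ifP => // _.
  rewrite -mulrA ler_pdivrMl ?powR_gt0// -!powRM ?(ltW C0)//.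
  by rewrite ge0_ler_powR ?nnegrE ?mulr_ge0 ?(ltW C0) ?(ltW s0)// (len_cat_ge W).
move=> Hnull; apply: (@tree_limit_not_null _ _ (piece F) ell s (C^-1 * lo ^+ N) N T
  (piece_len_gt0 F) (@piece_diam _ _ F) _ (@piece_cat _ _ F) (@piece_side_by_side _ _ F) s0 _ _
  rho_child _ T_sum ord0 (coding F) N0 (coding_in F) (@piece_len_small _ _ F)); last first.
- apply: hausdorff_null_sub Hnull => _ [x Tx <-]; exists x => //.
  (* The sum is at most M at multiples of N and moves by at most M per letter in between. *)
  exists (M + M *+ N) => n; rewrite (divn_eq n N) prefix_ofD wsum_cat.
  rewrite (le_trans (ler_normD _ _))// lerD//; first exact: Tx.
  rewrite (le_trans (wsum_norm_le _ XM))// size_prefix_of.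
  by rewrite ler_wpMn2l ?(ltW M0)// ltnW// ltn_mod.
- by rewrite /T wsum_nil normr0 ltW.
- by rewrite mulr_ile1 ?invr_ge0 ?exprn_ge0 ?exprn_ile1 ?(ltW (weights_lo W)) ?(ltW C0)// invf_le1// (weights_C W).
- by rewrite mulr_gt0 ?invr_gt0 ?exprn_gt0 ?(weights_lo W).
- move=> w; exists (ibranch_word F w 0), (ibranch_word F w 1); split=> //.
  + exact: piece_end0.
  + exact: piece_end1.
Qed.

(** Removing the end points costs nothing, as they form a countable set, null for every positive
    exponent. *)
Lemma dim_ge_bounded_orbits X (E : set R) : mean X = 0 ->
  coding F @` bounded_orbits X `\` endpoints F `<=` E -> (delta%:E <= hausdorff_dim E)%E.
Proof.
move=> X0 XE; apply: hausdorff_dim_ge => t t0 Et; rewrite leNgt; apply/negP => td.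
(* The midpoint is positive even when t = 0, as the nullity of the end points requires. *)
pose s := (t + delta) / 2.
have sd : 0 < s < delta by rewrite /s; apply/andP; split; lra.
have ts : t <= s by rewrite /s; lra.
apply: (bounded_orbits_not_null X0 sd).
apply: (hausdorff_null_sub (E' := \bigcup_(b : bool) if b then E else endpoints F)).
  move=> y By; have [yD|yD] := pselect (endpoints F y); first by exists false.
  by exists true => //; apply: XE.
apply: hausdorff_null_bigcup => -[]; last by apply: endpoints_null; case/andP: sd.
by apply: hausdorff_null_mono Et; rewrite t0.
Qed.

(** Bowen's formula: for X = 0 every code has a bounded orbit, so the lower bound applies to the
    whole coded set. *)
Lemma dim_lift_dom : hausdorff_dim (lift_dom F) = delta%:E.
Proof.
apply/eqP; rewrite eq_le dim_lift_dom_le/=.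
apply: (@dim_ge_bounded_orbits (fun=> 0)).
  by rewrite /mean big1// => i _; rewrite mulr0.
move=> _ [[x _ <-] xD]; exists (coding F x, 0) => /=; last by rewrite addr0.
by split=> //; split=> //; exists x.
Qed.

Lemma uniformly_recurrent_sub : uniformly_recurrent_set F Psi `<=` recurrent_set F Psi.
Proof. by move=> t [tL [K HK]]; split=> //; exists K => N; exists N. Qed.

Lemma dim_uniformly_recurrent_ge : mean step_letter = 0 ->
  (delta%:E <= hausdorff_dim (uniformly_recurrent_set F Psi))%E.
Proof.
move=> X0; apply: (dim_ge_bounded_orbits X0).
move=> _ [[x [K HK] <-] xD]; split.
  exists (coding F x, 0) => /=; last by rewrite addr0.
  by split=> //; split=> //; exists x.
exists (1 + K) => n; have := iter_psi_lift Psi_const 0 n xD; rewrite addr0 => ->.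
rewrite addr0 birkhoff_step_length (le_trans (ler_normD _ _))// lerD//.
have := coding_unit F (iter n left_shift x); rewrite /= in_itv/= => /andP[c0 c1].
by rewrite ger0_norm.
Qed.

(** Sandwiching E treats both recurrent sets at once: the lower bound is proved for the smaller set
    and the upper bound for the larger. *)
Lemma dimension_gapP (E : set R) :
  uniformly_recurrent_set F Psi `<=` E -> E `<=` recurrent_set F Psi ->
  dimension_gap F E <-> mean step_letter <> 0.
Proof.
move=> uE Er; rewrite /dimension_gap dim_lift_dom; split=> [+ X0|/eqP/dim_recurrent_lt[s sd H]].
  by rewrite ltNge (le_trans (dim_uniformly_recurrent_ge X0) (hausdorff_dim_mono uE)).
apply: le_lt_trans (hausdorff_dim_mono Er) _; apply: le_lt_trans H _.
by rewrite lte_fin.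
Qed.

End lift_dimension.

Theorem theorem1p4 (R : realType) (p : nat) (F : expanding_map R 'I_p.+2)
    (Psi : R -> int)
    (Psi_const : forall i x y, edom F i x -> edom F i y -> Psi x = Psi y)
    (delta : R) (delta_gt0 : 0 < delta)
    (delta_bowen : pressure (fun x => delta * geom_potential F x) = 0)
    (mu : probability (borel_sigma R p) R)
    (mu_gibbs : gibbs_measure (fun x => delta * geom_potential F x) mu)
    (alpha : R) :
  (exists2 K0 : R, 0 < K0 & forall K : R, K0 <= K ->
     poincare_exponent F Psi alpha K = delta <->
     (\int[mu]_x ((step_length F Psi x)%:~R)%:E = alpha%:E)%E) /\
  (dimension_gap F (recurrent_set F Psi) <->
     (\int[mu]_x ((step_length F Psi x)%:~R)%:E <> 0)%E) /\
  (dimension_gap F (uniformly_recurrent_set F Psi) <->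
     (\int[mu]_x ((step_length F Psi x)%:~R)%:E <> 0)%E).
Proof.
rewrite integral_step_length.
have eqE (a b : R) : (a%:E = b%:E)%E <-> a = b by split=> [[]|->].
split; last split.
- have [K0 K00 H] := poincare_exponentP Psi delta_gt0 delta_bowen mu_gibbs alpha.
  by exists K0 => // K /H ->; rewrite eqE.
- rewrite eqE; apply: (dimension_gapP Psi_const delta_gt0 delta_bowen mu_gibbs) => //.
  exact: uniformly_recurrent_sub.
- rewrite eqE; apply: (dimension_gapP Psi_const delta_gt0 delta_bowen mu_gibbs) => //.
  exact: uniformly_recurrent_sub.
Qed.
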